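(* There exists a smooth symplectic diffeomorphism $\Phi:\mathbb R^4\to\mathbb R^4$ (with respect to $\omega_0=\sum_{j=1}^2dy_j\wedge dx_j$) so that $$\widetilde{\mathcal M}_E':=\Phi^{-1}(\widetilde{\mathcal M}_E)\ \text{ is strictly convex for every } E\le E_c=-9/2.$$ More precisely, $\Phi$ is the symplectic shear given by $$\Phi(y,x)=(y+\nabla G_0(x),x),\qquad\forall (y,x)\in\mathbb R^4,$$ where $G_0(x):=\frac23(x_1^2-x_2^2)x_1x_2$ for every $x\in\mathbb R^2$. The new Hamiltonian becomes $$\hat K(y,x):=K\circ\Phi(y,x)=\frac{(y_1-\frac83x_2^3)^2}{2}+\frac{(y_2+\frac83x_1^3)^2}{2}+2(x_1^2+x_2^2)\big(2-3(x_1^2-x_2^2)^2\big).$$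
   Context: Let $$K(y,x)=\tfrac12(y_1-2|x|^2x_2)^2+\tfrac12(y_2+2|x|^2x_1)^2+V(x),\qquad V(x)=2|x|^2\big(2-3(x_1^2-x_2^2)^2\big),$$ for $(y,x)\in\mathbb R^2\times\mathbb R^2=\mathbb R^4$ (the regularized Hamiltonian of Hill's lunar problem). For $E<0$ put $h(E)=12/|E|^{3/2}$; $E_c=-9/2$ corresponds to the critical value $h_c=h(E_c)=8\sqrt2/9$ of $K$. For $E<E_c$, $\widetilde{\mathcal M}_E\subset K^{-1}(h(E))$ is the component of $K^{-1}(h(E))$ diffeomorphic to $S^3$, i.e. the one projecting to the component containing $x=0$ of $\{V\le h(E)\}$ in the $x$-plane. For $E=E_c$, $\widetilde{\mathcal M}_{E_c}\subset K^{-1}(h_c)$ is the limit of $\widetilde{\mathcal M}_E$ as $E\to E_c^-$, i.e. the part of $K^{-1}(h_c)$ projecting to the closure of the component containing $x=0$ of $\{V<h_c\}$; it is a topological three-sphere with four singular points, located over the critical points $\pm(2^{1/4}/\sqrt3,0)$, $\pm(0,2^{1/4}/\sqrt3)$ of $V$. Strict convexity: let $\mathcal M\hookrightarrow\mathbb R^4$ be an embedded topological three-sphere, possibly with a finite set $S$ of singularities, and smooth at the remaining points. $\mathcal M$ is strictly convex if it bounds a convex subset of $\mathbb R^4$ and all the sectional curvatures of $\mathcal M\setminus S$ are positive. In particular, any hyperplane tangent to $\mathcal M$ at a regular point $p\in\mathcal M\setminus S$ has contact of order $1$ with $\mathcal M$ and intersects $\mathcal M$ only at $p$. *)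

(* Defs.v *)
From HB Require Import structures.
From mathcomp Require Import all_boot all_order all_algebra.
From mathcomp Require Import all_classical all_reals all_analysis.
Set Implicit Arguments.
Unset Strict Implicit.
Unset Printing Implicit Defensive.
Import Order.TTheory GRing.Theory Num.Theory.
Import numFieldNormedType.Exports.
Local Open Scope classical_set_scope.
Local Open Scope ring_scope.

(* The topology of 'rV[R]_n is the usual one of R^n, but its library norm is
   the sup norm; metric notions below therefore use [dot]. *)
Definition dot (R : realType) n (u v : 'rV[R]_n) : R :=
  \sum_i u ord0 i * v ord0 i.

Definition basis_vec (R : realType) n (i : 'I_n) : 'rV[R]_n :=
  delta_mx ord0 i.

Definition grad (R : realType) n (f : 'rV[R]_n -> R) (x : 'rV[R]_n) : 'rV[R]_n :=
  \row_i 'D_(basis_vec R i) f x.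

Fixpoint Ck_on (R : realType) (V W : normedModType R) (k : nat) (U : set V)
    (f : V -> W) : Prop :=
  match k with
  | 0 => forall x, U x -> {for x, continuous f}
  | k'.+1 => (forall x, U x -> differentiable f x) /\
             forall v, Ck_on k' U ('D_v f)
  end.

(* Meant for open [U]. *)
Definition smooth_on (R : realType) (V W : normedModType R) (U : set V)
    (f : V -> W) : Prop := forall k, Ck_on k U f.

(* The metric [g] is given by its matrix in coordinates. *)
Section Riemannian.
Variables (R : realType) (n : nat) (g : 'rV[R]_n -> 'M[R]_n).
Implicit Types (u a b : 'rV[R]_n) (i j k l m : 'I_n).

Definition inner u a b : R := \sum_i \sum_j a ord0 i * g u i j * b ord0 j.

(* Gamma^k_{ij} *)
Definition christoffel k i j u : R :=
  2^-1 * \sum_l invmx (g u) k l *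
    ('D_(basis_vec R i) (fun w => g w j l) u
     + 'D_(basis_vec R j) (fun w => g w i l) u
     - 'D_(basis_vec R l) (fun w => g w i j) u).

(* The [l]-th component of R(d_i, d_j) d_k, with
   R(X, Y) Z = nabla_X nabla_Y Z - nabla_Y nabla_X Z - nabla_[X,Y] Z. *)
Definition riemann l i j k u : R :=
  'D_(basis_vec R i) (christoffel l j k) u
  - 'D_(basis_vec R j) (christoffel l i k) u
  + \sum_m (christoffel l i m u * christoffel m j k u
            - christoffel l j m u * christoffel m i k u).

(* R(a, b) b; [inner u (curvature_op u a b) a] is positive on round spheres. *)
Definition curvature_op u a b : 'rV[R]_n :=
  \row_l \sum_i \sum_j \sum_k
    a ord0 i * b ord0 j * b ord0 k * riemann l i j k u.

Definition sectional_curvature u a b : R :=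
  inner u (curvature_op u a b) a
  / (inner u a a * inner u b b - inner u a b ^+ 2).

End Riemannian.

(* First fundamental form of a parametrization [phi]. *)
Definition induced_metric (R : realType) m n (phi : 'rV[R]_m -> 'rV[R]_n)
    (u : 'rV[R]_m) : 'M[R]_m :=
  \matrix_(i, j) dot ('D_(basis_vec R i) phi u) ('D_(basis_vec R j) phi u).

Section Hypersurface.
Variables (R : realType) (n : nat) (M : set 'rV[R]_n.+1).

(* Near [p], [M] is a regular level set of a smooth function, i.e. a smooth
   embedded hypersurface. *)
Definition regular_point (p : 'rV[R]_n.+1) : Prop :=
  M p /\
  exists (W : set 'rV[R]_n.+1) (f : 'rV[R]_n.+1 -> R),
    [/\ open W, W p, smooth_on W f,
        forall z, W z -> grad f z != 0
      & M `&` W = [set z | W z /\ f z = 0]].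

Definition singular_points : set 'rV[R]_n.+1 :=
  [set p | M p /\ ~ regular_point p].

(* Domain and codomain of the immersion [phi] have dimensions n and n.+1, so
   near a regular point its image is open in [M]; such [phi] exist through
   every regular point by the implicit function theorem. *)
Definition local_parametrization (U : set 'rV[R]_n)
    (phi : 'rV[R]_n -> 'rV[R]_n.+1) : Prop :=
  [/\ open U, smooth_on U phi,
      forall u, U u -> injective ('d phi u : 'rV[R]_n -> 'rV[R]_n.+1)
    & forall u, U u -> M (phi u)].

Definition positively_curved_at (p : 'rV[R]_n.+1) : Prop :=
  forall (U : set 'rV[R]_n) (phi : 'rV[R]_n -> 'rV[R]_n.+1) (u a b : 'rV[R]_n),
    local_parametrization U phi -> U u -> phi u = p -> free [:: a; b] ->
    0 < sectional_curvature (induced_metric phi) u a b.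

End Hypersurface.

Definition homeomorphic (S T : topologicalType) (A : set S) (B : set T) : Prop :=
  exists (f : S -> T) (f' : T -> S),
    [/\ {within A, continuous f}, {within B, continuous f'},
        forall x, A x -> B (f x) /\ f' (f x) = x
      & forall y, B y -> A (f' y) /\ f (f' y) = y].

Definition euclidean_sphere (R : realType) n : set 'rV[R]_n.+1 :=
  [set u | dot u u = 1].

Definition bounds_convex (R : realType) n (M : set 'rV[R]_n) : Prop :=
  exists C : set 'rV[R]_n,
    [/\ convex_set C, bounded_set C & M = closure C `\` C°].

(* A topological three-sphere, smooth except at finitely many singularities. *)
Definition strictly_convex (R : realType) (M : set 'rV[R]_4) : Prop :=
  [/\ homeomorphic (@euclidean_sphere R 3) M,
      finite_set (singular_points M),
      bounds_convex M
    & forall p, regular_point M p -> positively_curved_at M p].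

Section Symplectic.
Variables (R : realType) (n : nat).

(* sum_j dy_j /\ dx_j, the point (y, x) being encoded as [row_mx y x]. *)
Definition omega0 (u v : 'rV[R]_(n + n)) : R :=
  dot (lsubmx u) (rsubmx v) - dot (rsubmx u) (lsubmx v).

Definition symplectic (Phi : 'rV[R]_(n + n) -> 'rV[R]_(n + n)) : Prop :=
  forall z u v, omega0 ('d Phi z u) ('d Phi z v) = omega0 u v.

Definition smooth_diffeo (Phi : 'rV[R]_(n + n) -> 'rV[R]_(n + n)) : Prop :=
  smooth_on setT Phi /\
  exists Psi : 'rV[R]_(n + n) -> 'rV[R]_(n + n),
    [/\ smooth_on setT Psi, cancel Phi Psi & cancel Psi Phi].

End Symplectic.

Section Hill.
Variable R : realType.
Implicit Types (x y : 'rV[R]_2) (z : 'rV[R]_(2 + 2)) (E : R).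

Definition fst2 x : R := x ord0 ord0.
Definition snd2 x : R := x ord0 ord_max.

Definition potential x : R :=
  2 * dot x x * (2 - 3 * (fst2 x ^+ 2 - snd2 x ^+ 2) ^+ 2).

Definition hamiltonian z : R :=
  let y := lsubmx z in let x := rsubmx z in
  2^-1 * (fst2 y - 2 * dot x x * snd2 x) ^+ 2
  + 2^-1 * (snd2 y + 2 * dot x x * fst2 x) ^+ 2 + potential x.

Definition level E : R := 12 / `|E| `^ (3 / 2).

Definition E_crit : R := - (9 / 2).

Definition hill_region E : set 'rV[R]_2 :=
  if E < E_crit then connected_component [set x | potential x <= level E] 0
  else closure (connected_component [set x | potential x < level E] 0).

(* Only meaningful for [E <= E_crit]. *)
Definition hill_sphere E : set 'rV[R]_(2 + 2) :=
  [set z | hamiltonian z = level E /\ hill_region E (rsubmx z)].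

Definition G0 x : R :=
  2 / 3 * (fst2 x ^+ 2 - snd2 x ^+ 2) * fst2 x * snd2 x.

End Hill.

(* Main.v *)
From Stdlib Require Import ZArith.
Require Import Defs.
From HB Require Import structures.
From mathcomp Require Import all_boot all_order all_algebra.
From mathcomp Require Import all_classical all_reals all_analysis.
From mathcomp Require Import ring lra ssrZ.
Set Implicit Arguments.
Unset Strict Implicit.
Unset Printing Implicit Defensive.
Import Order.TTheory GRing.Theory Num.Theory.
Import numFieldNormedType.Exports.
Local Open Scope classical_set_scope.
Local Open Scope ring_scope.

(** Write u = y - a(x) with a(x) = (8/3 x2^3, - 8/3 x1^3) and let V be the
    potential.  After the shear the Hamiltonian is K = |u|^2 / 2 + V(x).  The
    gain is that a depends on x through separated variables: the term
    u . a''(w, w) = 16 (u1 x2 w2^2 - u2 x1 w1^2) of the Hessian of K is diagonal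
    in w.

    Put c = sqrt 2 / 3.  On the curves |x1^2 - x2^2| = c the potential is at
    least its critical value 8 c / 3, with equality at the four saddles only
    ([pot_edge], [pot_corner]).  Hence for all levels h <= 8 c / 3 the Hill
    region is {V <= h, |x1^2 - x2^2| <= c} ([hill_regionE]), and the energy
    surface is the part of K = h lying over it, [shell h]; it bounds [body h].

    Everything rests on one estimate ([hkhat_gt0]): at a point of the surface
    that is not over a saddle, the Hessian of K is positive definite on the
    kernel of the differential of K.  Let g be the gradient of V.  For a tangent
    vector whose x-component is w, Cauchy-Schwarz bounds the contribution of its
    y-component from below by (g . w)^2 / |u|^2, so one has to compare
    N = S Hess V + g g^T, where S >= |u|^2 is twice the gap between V and the
    critical value, with the diagonal term coming from a''.  Replacing |u|^2 by S
    only makes the claim harder; this is why the critical level is the worst one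
    and all levels are handled at once.  A second use of Cauchy-Schwarz turns the
    comparison of determinants into the positivity of one polynomial [discr] in
    the squares p, q of the rescaled coordinates ([tangential_hessian_gt0]).
    That polynomial vanishes at the saddle p = 1, q = 0.  In the coordinates
    e = 1 - (p - q) and t with q = e^2 (9 - 5 e) t, which straighten the Hill
    region, it is divisible by e^6, and the quotient is positive because all its
    Bernstein coefficients are; this is checked by computation
    ([check_boxP], [estimate_ordered]).

    The consequences are the following.

    - Curvature.  By the Gauss equation ([gauss_equation],
      [curvature_numerator]) the sectional curvatures of an immersion into a
      level set of K are quotients of Gram determinants of the tangential Hessian
      and of the metric, so the estimate makes them positive.  Over a saddle
      there is no immersion at all: K would be constant along it, so its tangent
      vectors would be isotropic for the Hessian of K, whose index is one
      ([shell_curved]).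

    - Convexity.  [dilate s] shrinks the body into its interior for s < 1.  The
      segment joining two dilated points stays in the body as s increases from
      0, because when it first touched the boundary K would have a local maximum
      along it at the contact point, against the estimate
      ([no_tangent_segment], [seg_all_inner], [body_convex]).

    - Topology.  (u, sqrt (2 V) x / |x|) maps the surface bijectively and
      continuously onto a round sphere, and the surface is compact
      ([shell_sphere]). *)

(** * Positivity of polynomials on a box *)

Section CoefficientLists.
Variables (T : Type) (zero : T) (add mul : T -> T -> T) (scal : T -> T).

Fixpoint add_coefs (a b : seq T) : seq T :=
  match a, b with
  | [::], _ => b
  | _, [::] => a
  | x :: a', y :: b' => add x y :: add_coefs a' b'
  end.

Fixpoint mul_coefs (a b : seq T) : seq T :=
  if a is x :: a' then add_coefs (map (mul x) b) (zero :: mul_coefs a' b)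
  else [::].

(** A list h of length n + 1 also stands for the form
    sum_i h_i e^i f^(n - i); this multiplies it by c e + f. *)
Definition raise_degree (h : seq T) : seq T :=
  add_coefs (rcons h zero) (zero :: map scal h).

(** Homogenization: every monomial of a polynomial in e is completed to the full
    degree by powers of c e + f.  On the line c e + f = 1 nothing changes, and
    the new coefficients are the Bernstein coefficients up to binomials. *)
Fixpoint bernstein (a : seq T) : seq T :=
  if a is x :: a' then
    add_coefs (iter (size a') raise_degree [:: x]) (zero :: bernstein a')
  else [::].

Variables (R : realFieldType) (ev : T -> R) (e : R).
Hypothesis ev0 : ev zero = 0.
Hypothesis evD : forall x y, ev (add x y) = ev x + ev y.

Fixpoint horner_eval (a : seq T) : R :=
  if a is x :: a' then ev x + e * horner_eval a' else 0.

Lemma horner_evalD a b :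
  horner_eval (add_coefs a b) = horner_eval a + horner_eval b.
Proof.
elim: a b => [|x a IHa] [|y b] /=; rewrite ?add0r ?addr0//.
by rewrite evD IHa; ring.
Qed.

Lemma horner_evalM : (forall x y, ev (mul x y) = ev x * ev y) ->
  forall a b, horner_eval (mul_coefs a b) = horner_eval a * horner_eval b.
Proof.
move=> evM; elim=> [|x a IHa] b /=; first by rewrite mul0r.
rewrite horner_evalD /= ev0 IHa.
suff -> : horner_eval (map (mul x) b) = ev x * horner_eval b by ring.
by elim: b => [|y b IHb] /=; rewrite ?mulr0 // evM IHb; ring.
Qed.

Variables (c f : R).
Hypothesis ev_scal : forall x, ev (scal x) = c * ev x.
Hypothesis cef : c * e + f = 1.

Fixpoint form_eval (h : seq T) : R :=
  if h is x :: h' then ev x * f ^+ size h' + e * form_eval h' else 0.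

Lemma size_add_coefs a b :
  size a = size b -> size (add_coefs a b) = size b.
Proof. by elim: a b => [|x a IHa] [|y b] //= [/IHa->]. Qed.

Lemma form_evalD a b : size a = size b ->
  form_eval (add_coefs a b) = form_eval a + form_eval b.
Proof.
elim: a b => [|x a IHa] [|y b] //= => [_|[sab]]; first by rewrite addr0.
by rewrite evD IHa // size_add_coefs // sab; ring.
Qed.

Lemma form_eval_rcons h : form_eval (rcons h zero) = f * form_eval h.
Proof.
elim: h => [|x h IHh] /=; first by rewrite ev0; ring.
by rewrite IHh size_rcons exprS; ring.
Qed.

Lemma form_eval_scal h : form_eval (map scal h) = c * form_eval h.
Proof.
by elim: h => [|x h IHh] /=; rewrite ?mulr0 // IHh ev_scal size_map; ring.
Qed.

Lemma size_raise_degree h : size (raise_degree h) = (size h).+1.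
Proof. by rewrite size_add_coefs /= ?size_rcons ?size_map. Qed.

Lemma form_eval_raise_degree h : form_eval (raise_degree h) = form_eval h.
Proof.
rewrite form_evalD /= ?size_rcons ?size_map// form_eval_rcons form_eval_scal.
by rewrite ev0 mul0r add0r mulrA -mulrDl (mulrC e c) addrC cef mul1r.
Qed.

Lemma size_iter_raise n h : size (iter n raise_degree h) = (n + size h)%N.
Proof. by elim: n => //= n IHn; rewrite size_raise_degree IHn. Qed.

Lemma form_eval_iter n h : form_eval (iter n raise_degree h) = form_eval h.
Proof. by elim: n => //= n IHn; rewrite form_eval_raise_degree. Qed.

Lemma size_bernstein a : size (bernstein a) = size a.
Proof.
elim: a => //= x a IHa.
by rewrite size_add_coefs /= ?size_iter_raise IHa ?addn1.
Qed.

Lemma bernsteinE a : form_eval (bernstein a) = horner_eval a.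
Proof.
elim: a => //= x a IHa.
rewrite form_evalD /= ?size_iter_raise ?addn1 ?size_bernstein//.
by rewrite form_eval_iter /= ev0 IHa expr0; ring.
Qed.

(** Nonnegative Bernstein coefficients give a nonnegative value for e, f >= 0,
    since the form is then a sum of nonnegative terms. *)
Lemma horner_eval_ge0 (nonneg : T -> bool) a :
  0 <= e -> 0 <= f -> (forall x, nonneg x -> 0 <= ev x) ->
  all nonneg (bernstein a) -> 0 <= horner_eval a.
Proof.
move=> e0 f0 nnP; rewrite -bernsteinE.
elim: (bernstein a) => //= x h IHh /andP[xnn /IHh hnn].
by rewrite addr_ge0 ?mulr_ge0 ?exprn_ge0 ?nnP.
Qed.

End CoefficientLists.

(** Polynomial expressions in e and t, so that one expression can be evaluated
    both in a field and in lists of integer coefficients. *)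
Inductive pexpr :=
  | PVarE | PVarT | PCst of nat
  | PAdd of pexpr & pexpr | PSub of pexpr & pexpr | PMul of pexpr & pexpr.

Fixpoint interp (R : pzRingType) (e t : R) (x : pexpr) : R :=
  match x with
  | PVarE => e
  | PVarT => t
  | PCst n => n%:R
  | PAdd x y => interp e t x + interp e t y
  | PSub x y => interp e t x - interp e t y
  | PMul x y => interp e t x * interp e t y
  end.

Definition add_inner := add_coefs Z.add.
Definition mul_inner := mul_coefs Z0 Z.add Z.mul.
Definition add_outer := add_coefs add_inner.
Definition mul_outer := mul_coefs [::] add_inner mul_inner.
Arguments add_outer : simpl never.
Arguments mul_outer : simpl never.

(** Polynomials in e whose coefficients are polynomials in t. *)
Fixpoint coefs (x : pexpr) : seq (seq Z) :=
  match x with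
  | PVarE => [:: [::]; [:: Z.pos xH]]
  | PVarT => [:: [:: Z0; Z.pos xH]]
  | PCst n => [:: [:: Z.of_nat n]]
  | PAdd x y => add_outer (coefs x) (coefs y)
  | PSub x y => add_outer (coefs x) (mul_outer [:: [:: Z.neg xH]] (coefs y))
  | PMul x y => mul_outer (coefs x) (coefs y)
  end.

(** Certifies that the expression is at least e^k on [0, 1] x [0, 1/12].  The
    factor e^k is split off first, because the expressions of interest vanish on
    the line e = 0; Bernstein coefficients are then taken in e and, for each of
    the polynomials in t so obtained, in t. *)
Definition check_box (k : nat) (x : pexpr) : bool :=
  let a := coefs x in
  all (all (Z.eqb Z0)) (take k a) &&
  all (fun h => all (Z.leb Z0) (bernstein Z0 Z.add (Z.mul (Z.of_nat 12)) h))
    (bernstein [::] add_inner id (add_outer (drop k a) [:: [:: Z.neg xH]])).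

Section CheckBox.
Variables (R : realFieldType) (e t : R).

Definition evZ (z : Z) : R := (int_of_Z z)%:~R.

Lemma evZ0 : evZ Z0 = 0. Proof. by []. Qed.
Lemma evZD x y : evZ (Z.add x y) = evZ x + evZ y.
Proof. by rewrite /evZ (rmorphD int_of_Z) rmorphD. Qed.
Lemma evZM x y : evZ (Z.mul x y) = evZ x * evZ y.
Proof. by rewrite /evZ (rmorphM int_of_Z) rmorphM. Qed.
Lemma evZ_nat n : evZ (Z.of_nat n) = n%:R.
Proof. by rewrite /evZ -[Z.of_nat n]/(Z_of_int n) Z_of_intK. Qed.
Lemma evZ_ge0 z : Z.leb Z0 z -> 0 <= evZ z.
Proof. by case: z => //= p _; rewrite /evZ /= ler0n. Qed.

Let evt := horner_eval evZ t.
Let eve := horner_eval evt e.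

Lemma eve_coefs x : eve (coefs x) = interp e t x.
Proof.
have evtD := horner_evalD t evZD.
have evtM := horner_evalM t evZ0 evZD evZM.
have eveD := horner_evalD e evtD.
have eveM := horner_evalM e (erefl : evt [::] = 0) evtD evtM.
elim: x => [||n|x IHx y IHy|x IHx y IHy|x IHx y IHy] /=.
- by rewrite /eve /evt /=; have -> : evZ (Z.pos xH) = 1 by []; ring.
- by rewrite /eve /evt /=; have -> : evZ (Z.pos xH) = 1 by []; rewrite evZ0; ring.
- by rewrite /eve /evt /= evZ_nat; ring.
- by rewrite -IHx -IHy; exact: eveD.
- rewrite -IHx -IHy [LHS]eveD; congr (_ + _); rewrite [LHS]eveM /= /evt /=.
  by have -> : evZ (Z.neg xH) = -1 by []; rewrite -/evt -/eve; ring.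
- by rewrite -IHx -IHy; exact: eveM.
Qed.

Lemma check_boxP k x : 0 <= e <= 1 -> 0 <= t -> 12 * t <= 1 ->
  check_box k x -> e ^+ k <= interp e t x.
Proof.
move=> /andP[e0 e1] t0 t1 /andP[zk nn].
have evtD := horner_evalD t evZD.
have eveD := horner_evalD e evtD.
have nn0 : 0 <= eve (add_outer (drop k (coefs x)) [:: [:: Z.neg xH]]).
  have := @horner_eval_ge0 _ [::] add_inner id R evt e (erefl : evt [::] = 0) evtD
    1 (1 - e) _ _ _ _ e0 _ _ nn; apply.
  - by move=> y; rewrite mul1r.
  - by ring.
  - by rewrite subr_ge0.
  move=> h hnn.
  have := @horner_eval_ge0 _ Z0 Z.add (Z.mul (Z.of_nat 12)) R evZ t evZ0 evZD
    12 (1 - 12 * t) _ _ _ _ t0 _ _ hnn; apply.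
  - by move=> y; rewrite evZM.
  - by ring.
  - by rewrite subr_ge0.
  exact: evZ_ge0.
have eE : eve (coefs x) = e ^+ k * eve (drop k (coefs x)).
  elim: k (coefs x) zk {nn nn0} => [|k IHk] [|a l] /=.
  - by rewrite mulr0.
  - by rewrite expr0 mul1r.
  - by rewrite /eve /= mulr0.
  move=> /andP[a0 /IHk ih].
  transitivity (evt a + e * eve l); first by [].
  rewrite ih.
  suff -> : evt a = 0 by rewrite add0r exprS mulrA.
  elim: a a0 => //= z a IHa /andP[z0 /IHa].
  have <- : Z0 = z by case: z z0.
  by rewrite /evt /= => ->; rewrite evZ0; ring.
rewrite -eve_coefs eE -[leLHS]mulr1 ler_wpM2l ?exprn_ge0//.
move: nn0; rewrite [eve _]eveD /= /evt /=; have -> : evZ (Z.neg xH) = -1 by [].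
by rewrite -/evt -/eve; lra.
Qed.

End CheckBox.

Section Polys.
Variable R : comPzRingType.
Implicit Types p q : R.

(** With p, q the squares of the coordinates, rescaled so that the saddles are at
    (1, 0) and (0, 1), and with the critical value rescaled to 1, the potential is
    (p + q) (3 - (p - q)^2) / 2.  [slack] is twice its gap to the critical
    value. *)
Definition slack p q : R := 2 - (p + q) * (3 - (p - q) ^+ 2).

(** The partial derivatives of the rescaled potential are x1 * [grad1 p q] and
    x2 * [grad1 q p]; its second ones are [hess11 p q], [hess11 q p] and
    4 x1 x2 (p + q). *)
Definition grad1 p q : R := 3 - 3 * p ^+ 2 + 2 * p * q + q ^+ 2.
Definition hess11 p q : R := 3 - 15 * p ^+ 2 + 6 * p * q + q ^+ 2.

(** A diagonal coefficient of slack * Hess + grad grad^T. *)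
Definition quad11 p q := slack p q * hess11 p q + p * grad1 p q ^+ 2.

(** The determinant of slack * Hess + grad grad^T, divided by slack. *)
Definition quad_det p q : R :=
  slack p q * (hess11 p q * hess11 q p - 16 * p * q * (p + q) ^+ 2)
  + p * grad1 p q ^+ 2 * hess11 q p + q * grad1 q p ^+ 2 * hess11 p q
  - 8 * p * q * (p + q) * grad1 p q * grad1 q p.

(** Positive exactly when [quad_det] dominates, in absolute value, the largest
    perturbation of the determinant by the magnetic term; 64 / 3 is the square of
    the rescaled magnetic constant. *)
Definition discr p q : R :=
  3 * quad_det p q ^+ 2
  - 64 * slack p q * (p * quad11 q p ^+ 2 + q * quad11 p q ^+ 2).
End Polys.

Section PolysX.
Local Notation "x + y" := (PAdd x y).
Local Notation "x - y" := (PSub x y).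
Local Notation "x * y" := (PMul x y).
Local Notation "x ^+ 2" := (PMul x x).
Implicit Types p q : pexpr.
Definition slackX p q := PCst 2 - (p + q) * (PCst 3 - (p - q) ^+ 2).
Definition grad1X p q := PCst 3 - PCst 3 * p ^+ 2 + PCst 2 * p * q + q ^+ 2.
Definition hess11X p q := PCst 3 - PCst 15 * p ^+ 2 + PCst 6 * p * q + q ^+ 2.
Definition quad11X p q := slackX p q * hess11X p q + p * grad1X p q ^+ 2.
Definition quad_detX p q :=
  slackX p q * (hess11X p q * hess11X q p - PCst 16 * p * q * (p + q) ^+ 2)
  + p * grad1X p q ^+ 2 * hess11X q p + q * grad1X q p ^+ 2 * hess11X p q
  - PCst 8 * p * q * (p + q) * grad1X p q * grad1X q p.
Definition discrX p q :=
  PCst 3 * quad_detX p q ^+ 2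
  - PCst 64 * slackX p q * (p * quad11X q p ^+ 2 + q * quad11X p q ^+ 2).
Definition qX := PVarE ^+ 2 * (PCst 9 - PCst 5 * PVarE) * PVarT.
Definition pX := PCst 1 - PVarE + qX.
End PolysX.

(** The exponents 6, 3 and 2 are the powers of e that divide these polynomials. *)
Lemma check_discr : check_box 6 (discrX pX qX). Proof. by vm_compute. Qed.
Lemma check_det : check_box 3 (quad_detX pX qX). Proof. by vm_compute. Qed.
Lemma check_quad : check_box 2 (quad11X qX pX). Proof. by vm_compute. Qed.

(** * The reduced inequality *)

Section Reduced.
Variable R : realFieldType.
Implicit Types p q : R.

Lemma slackC p q : slack p q = slack q p.
Proof. by rewrite /slack; ring. Qed.
Lemma quad_detC p q : quad_det p q = quad_det q p.
Proof. by rewrite /quad_det (slackC q p); ring. Qed.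
Lemma discrC p q : discr p q = discr q p.
Proof. by rewrite /discr (slackC q p) (quad_detC q p); ring. Qed.

(** The coordinate e = 1 - (p - q) vanishes at the saddle, and the
    condition slack >= 0 reads 2 q (2 + 2 e - e^2) <= e^2 (3 - e).  Its convex
    upper boundary q / e^2 lies below its chord (9 - 5 e) / 12, which gives the box
    coordinate t = q / (e^2 (9 - 5 e)) <= 1 / 12. *)
Lemma estimate_ordered p q : 0 <= q -> q <= p -> p - q < 1 -> 0 <= slack p q ->
  [/\ 0 < discr p q, 0 < quad_det p q & 0 < quad11 q p].
Proof.
move=> q0 qp pq1 s0.
pose e := 1 - (p - q).
have e0 : 0 < e by rewrite /e; lra.
have e1 : e <= 1 by rewrite /e; lra.
have n0 : 0 < e ^+ 2 * (9 - 5 * e) by rewrite mulr_gt0 ?exprn_gt0//; lra.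
pose t := q / (e ^+ 2 * (9 - 5 * e)).
have qE : q = interp e t qX.
  have -> : interp e t qX = e ^+ 2 * (9 - 5 * e) * t by [].
  by rewrite mulrC /t divfK // gt_eqF.
have pE : p = interp e t pX.
  have -> : interp e t pX = 1 - e + interp e t qX by [].
  by rewrite -qE /e; ring.
have t0 : 0 <= t by rewrite divr_ge0 // ltW.
have t1 : 12 * t <= 1.
  rewrite mulrA ler_pdivrMr // mul1r.
  have m0 : 0 < 2 + 2 * e - e ^+ 2.
    have : 0 <= e * (1 - e) by rewrite mulr_ge0 //; lra.
    by lra.
  have qm : 2 * q * (2 + 2 * e - e ^+ 2) <= e ^+ 2 * (3 - e).
    rewrite -subr_ge0 (_ : _ - _ = slack p q) //.
    by rewrite /slack /e; ring.
  have : e ^+ 2 * (6 * (3 - e)) <=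
      e ^+ 2 * ((9 - 5 * e) * (2 + 2 * e - e ^+ 2)).
    rewrite ler_wpM2l ?sqr_ge0 // -subr_ge0.
    rewrite (_ : _ - _ = e * (1 - e) * (14 - 5 * e)); last by ring.
    by rewrite !mulr_ge0 //; lra.
  by move=> h; rewrite -(ler_pM2r m0); lra.
have e01 : 0 <= e <= 1 by rewrite ltW.
have ek k : 0 < e ^+ k by rewrite exprn_gt0.
split.
- rewrite qE pE; exact: lt_le_trans (ek 6) (check_boxP e01 t0 t1 check_discr).
- rewrite qE pE; exact: lt_le_trans (ek 3) (check_boxP e01 t0 t1 check_det).
- rewrite qE pE; exact: lt_le_trans (ek 2) (check_boxP e01 t0 t1 check_quad).
Qed.

Lemma estimate p q : 0 <= p -> 0 <= q -> `|p - q| < 1 -> 0 <= slack p q ->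
  [/\ 0 < discr p q, 0 < quad_det p q & 0 < quad11 q p \/ 0 < quad11 p q].
Proof.
move=> p0 q0 /ltr_normlP[pq1 qp1] s0.
have [qp|/ltW pq] := leP q p.
  have [] := estimate_ordered q0 qp _ s0; first by lra.
  by move=> *; split=> //; left.
rewrite slackC in s0; have [] := estimate_ordered p0 pq _ s0; first by lra.
by rewrite discrC quad_detC => *; split=> //; right.
Qed.

End Reduced.

Lemma form2_gt0 (R : realFieldType) (a b c x y : R) :
  0 < a -> b ^+ 2 < a * c -> (x, y) != (0, 0) ->
  0 < a * x ^+ 2 + 2 * b * x * y + c * y ^+ 2.
Proof.
move=> a0 bac xy; rewrite -(pmulr_rgt0 _ a0).
rewrite [X in 0 < X](_ : _ = (a * x + b * y) ^+ 2 + (a * c - b ^+ 2) * y ^+ 2);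
  last by ring.
have [y0|y0] := eqVneq y 0.
  have x0 : x != 0 by apply: contraNneq xy => x0; rewrite x0 y0.
  rewrite y0 [X in 0 < X](_ : _ = (a * x) ^+ 2); last by ring.
  rewrite exprn_even_gt0 //=.
  by apply: mulf_neq0 => //; rewrite gt_eqF.
by rewrite ltr_wpDl ?sqr_ge0 // mulr_gt0 ?subr_gt0 // exprn_even_gt0.
Qed.

Section Tangent.
Variable R : realFieldType.
Implicit Types x y w u b k : R.

(** The rescaled form of the main estimate.  When slack > 0, Cauchy-Schwarz in
    the b variables reduces it to the 2x2 form with matrix
    slack * Hess + grad grad^T minus a diagonal term, whose signs may be taken to be
    the worst ones; when slack = 0 the magnetic term disappears and w is tangent to
    the level curve of the potential, whose curvature is [quad_det]. *)
Lemma tangential_hessian_gt0 x1 x2 u1 u2 b1 b2 w1 w2 k :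
  let p := x1 ^+ 2 in let q := x2 ^+ 2 in
  k ^+ 2 = 64 / 3 ->
  `|p - q| < 1 -> u1 ^+ 2 + u2 ^+ 2 <= slack p q ->
  u1 * b1 + u2 * b2 + x1 * grad1 p q * w1 + x2 * grad1 q p * w2 = 0 ->
  [|| b1 != 0, b2 != 0, w1 != 0 | w2 != 0] ->
  0 < b1 ^+ 2 + b2 ^+ 2 - k * (u1 * x2 * w2 ^+ 2 - u2 * x1 * w1 ^+ 2)
      + hess11 p q * w1 ^+ 2 + 2 * (4 * x1 * x2 * (p + q)) * w1 * w2
      + hess11 q p * w2 ^+ 2.
Proof.
move=> p q k2 pq1 us dK nz.
have p0 : 0 <= p by apply: sqr_ge0. have q0 : 0 <= q by apply: sqr_ge0.
have s0 : 0 <= slack p q by apply: le_trans us; rewrite addr_ge0 ?sqr_ge0.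
have [disc0 det0 quad0] := estimate p0 q0 pq1 s0.
have [w0|w0] := eqVneq (w1, w2) (0, 0).
  move: w0 nz => [-> ->]; rewrite eqxx !orbF => nz.
  rewrite [X in 0 < X](_ : _ = b1 ^+ 2 + b2 ^+ 2); last by ring.
  by case/orP: nz => nz; [apply: ltr_wpDr|apply: ltr_wpDl];
    rewrite ?sqr_ge0 // exprn_even_gt0.
set S := slack p q in us s0 *.
set g1 := x1 * grad1 p q in dK; set g2 := x2 * grad1 q p in dK.
pose h12 := 4 * x1 * x2 * (p + q).
(* on the boundary of the Hill region u = 0 *)
have [S0|S0] := eqVneq S 0.
  have u10 : u1 = 0.
    apply/eqP; rewrite -sqrf_eq0 eq_le sqr_ge0 andbT.
    by have := sqr_ge0 u2; move: us; rewrite S0; clear; lra.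
  have u20 : u2 = 0.
    apply/eqP; rewrite -sqrf_eq0 eq_le sqr_ge0 andbT.
    by have := sqr_ge0 u1; move: us; rewrite S0; clear; lra.
  rewrite u10 u20 !mul0r subr0 mulr0 subr0 -!addrA.
  rewrite ltr_wpDl ?sqr_ge0 // ltr_wpDl ?sqr_ge0 //.
  have gw : g1 * w1 + g2 * w2 = 0 by rewrite -dK u10 u20; ring.
  have detE : quad_det p q =
     hess11 p q * g2 ^+ 2 - 2 * h12 * g1 * g2 + hess11 q p * g1 ^+ 2.
    by rewrite /quad_det -/S S0 /g1 /g2 /h12 /p /q; ring.
  have w2gt : 0 < w1 ^+ 2 + w2 ^+ 2.
    move: w0; rewrite xpair_eqE negb_and => /orP[] nw;
      [apply: ltr_wpDr|apply: ltr_wpDl]; by rewrite ?sqr_ge0 // exprn_even_gt0.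
  have gE : (g1 ^+ 2 + g2 ^+ 2) * (hess11 p q * w1 ^+ 2 +
     (2 * h12 * w1 * w2 + hess11 q p * w2 ^+ 2)) = (w1 ^+ 2 + w2 ^+ 2) * quad_det p q.
    rewrite detE; apply/eqP; rewrite -subr_eq0 (_ : _ - _ =
      (g1 * w1 + g2 * w2) * (hess11 p q * (g1 * w1 - g2 * w2)
        + 2 * h12 * (g1 * w2 + g2 * w1)
        + hess11 q p * (g2 * w2 - g1 * w1))); last by ring.
    by rewrite gw mul0r.
  have g0 : 0 <= g1 ^+ 2 + g2 ^+ 2 by rewrite addr_ge0 ?sqr_ge0.
  have := mulr_gt0 w2gt det0; rewrite -gE.
  have [->|gn0] := eqVneq (g1 ^+ 2 + g2 ^+ 2) 0; first by rewrite mul0r ltxx.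
  by rewrite pmulr_rgt0 // lt_def gn0.
have {}S0 : 0 < S by rewrite lt_def S0.
pose n11 := quad11 p q; pose n22 := quad11 q p; pose n12 := S * h12 + g1 * g2.
have n11E : n11 = S * hess11 p q + g1 ^+ 2 by rewrite /n11 /quad11 -/S /g1 /p; ring.
have n22E : n22 = S * hess11 q p + g2 ^+ 2.
  by rewrite /n22 /quad11 slackC -/S /g2 /q; ring.
have detE : n11 * n22 - n12 ^+ 2 = S * quad_det p q.
  by rewrite n11E n22E /quad_det -/S /n12 /h12 /g1 /g2 /p /q; ring.
have n1122 : 0 < n11 * n22.
  by have := mulr_gt0 S0 det0; rewrite -detE; have := sqr_ge0 n12; lra.
have [n11_gt0 n22_gt0] : 0 < n11 /\ 0 < n22.
  case: quad0 => h; split=> //; first by rewrite -(pmulr_lgt0 _ h).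
  by rewrite -(pmulr_rgt0 _ h).
(* the magnetic term is dominated in absolute value, the worst case being that of
   two positive perturbations *)
pose a := `|k * S * (u2 * x1)|; pose b := `|k * S * (u1 * x2)|.
have a0 : 0 <= a by apply: normr_ge0.
have b0 : 0 <= b by apply: normr_ge0.
have ab : a * n22 + b * n11 < S * quad_det p q.
  have CS : (a * n22 + b * n11) ^+ 2 <=
      (k * S) ^+ 2 * ((u1 ^+ 2 + u2 ^+ 2) * (p * n22 ^+ 2 + q * n11 ^+ 2)).
    rewrite -subr_ge0 [X in 0 <= X](_ : _ =
       (k * S) ^+ 2 * (`|u1| * `|x1| * n22 - `|u2| * `|x2| * n11) ^+ 2).
      by rewrite mulr_ge0 ?sqr_ge0.
    rewrite /a /b !normrM -(real_normK (num_real u1)) -(real_normK (num_real u2)).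
    rewrite /p /q -(real_normK (num_real x1)) -(real_normK (num_real x2)).
    by rewrite exprMn -(real_normK (num_real k)) (ger0_norm (ltW S0)); ring.
  have abn : 0 <= a * n22 + b * n11 by rewrite addr_ge0 // mulr_ge0 // ltW.
  rewrite -ltr_sqr ?nnegrE // ?mulr_ge0 ?(ltW S0) ?(ltW det0) //.
  apply: le_lt_trans CS _.
  pose P := p * n22 ^+ 2 + q * n11 ^+ 2.
  have P0 : 0 <= P by rewrite addr_ge0 // mulr_ge0 ?sqr_ge0.
  apply: (@le_lt_trans _ _ ((k * S) ^+ 2 * (S * P))).
    by rewrite ler_wpM2l ?sqr_ge0 // ler_wpM2r.
  rewrite exprMn k2; have : 0 < S ^+ 2 * discr p q by rewrite mulr_gt0 ?exprn_gt0.
  by rewrite /discr -/S -/n11 -/n22 -/P; lra.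
have n11a : 0 < n11 - a.
  rewrite subr_gt0 -(ltr_pM2r n22_gt0).
  have : 0 <= b * n11 by rewrite mulr_ge0 // ltW.
  have := sqr_ge0 n12; lra.
have ndet : n12 ^+ 2 < (n11 - a) * (n22 - b).
  have : 0 <= a * b by rewrite mulr_ge0.
  lra.
have := form2_gt0 n11a ndet w0.
set lhs := (X in 0 < X -> _) => lhs0.
rewrite -(pmulr_rgt0 _ S0); apply: lt_le_trans lhs0 _.
have ub : (g1 * w1 + g2 * w2) ^+ 2 <= S * (b1 ^+ 2 + b2 ^+ 2).
  have -> : g1 * w1 + g2 * w2 = - (u1 * b1 + u2 * b2) by lra.
  apply: (@le_trans _ _ ((u1 ^+ 2 + u2 ^+ 2) * (b1 ^+ 2 + b2 ^+ 2))).
    rewrite -subr_ge0 [X in 0 <= X](_ : _ = (u1 * b2 - u2 * b1) ^+ 2); last by ring.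
    exact: sqr_ge0.
  by rewrite ler_wpM2r // addr_ge0 ?sqr_ge0.
have aw : - a * w1 ^+ 2 <= k * S * (u2 * x1) * w1 ^+ 2.
  by rewrite ler_wpM2r ?sqr_ge0 // lerNl /a -normrN ler_norm.
have bw : - b * w2 ^+ 2 <= - (k * S * (u1 * x2)) * w2 ^+ 2.
  by rewrite ler_wpM2r ?sqr_ge0 // lerN2 ler_norm.
rewrite /lhs n11E n22E /n12; move: ub aw bw; rewrite -/h12; lra.
Qed.
End Tangent.

(** * Mixed derivatives and smooth maps *)

Section Schwarz.
Variables (R : realType) (V : normedModType R).
Implicit Types (f : V -> R) (u v w x : V).

Lemma is_derive_line f x v (s d : R) : is_derive (x + s *: v) v f d ->
  is_derive s 1 (fun r : R => f (x + r *: v)) d.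
Proof.
have E : (fun h : R => h^-1 *: (f (x + (h%:A + s) *: v) - f (x + s *: v))) =
         (fun h : R => h^-1 *: (f (h *: v + (x + s *: v)) - f (x + s *: v))).
  by apply/funext => h; rewrite /= [h%:A]mulr1 scalerDl addrCA.
by move=> [df <-]; apply: DeriveDef; [rewrite /derivable E|rewrite /derive E].
Qed.

Lemma mvt_line (g dg : R -> R) (t : R) : 0 < t ->
  (forall r, 0 <= r <= t -> is_derive r 1 g (dg r)) ->
  exists2 c, 0 <= c <= t & g t - g 0 = t * dg c.
Proof.
move=> t0 gd.
have gc : {within `[0, t], continuous g}.
  apply: derivable_within_continuous => r; rewrite in_itv/= => rt.
  exact: (@ex_derive _ _ _ _ _ _ _ (gd r rt)).
have [r /[!in_itv]/= /andP[r0 rt]|c /[!in_itv]/= /andP[c0 ct] ->] :=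
  MVT (df := dg) t0 _ gc.
  by apply: gd; rewrite (ltW r0) (ltW rt).
by exists c; rewrite ?(ltW c0) ?(ltW ct) // subr0 mulrC.
Qed.

(** Applying the mean value theorem in the direction v and then in the direction w
    expresses the second difference of f by the mixed derivative at some point of
    the parallelogram. *)
Lemma mixed_difference f fv fwv u v w (t : R) : 0 < t ->
  (forall a b : R, 0 <= a <= t -> 0 <= b <= t ->
     is_derive (u + a *: v + b *: w) v f (fv (u + a *: v + b *: w)) /\
     is_derive (u + a *: v + b *: w) w fv (fwv (u + a *: v + b *: w))) ->
  exists a b : R, [/\ 0 <= a <= t, 0 <= b <= t &
    f (u + t *: v + t *: w) - f (u + t *: v) - f (u + t *: w) + f u =
    t ^+ 2 * fwv (u + a *: v + b *: w)].
Proof.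
move=> t0 df; have tt : 0 <= t <= t by rewrite lexx ltW.
have z0 : (0 : R) <= 0 <= t by rewrite lexx ltW.
pose g (r : R) := f (u + t *: w + r *: v) - f (u + r *: v).
pose dg (r : R) := fv (u + t *: w + r *: v) - fv (u + r *: v).
have [|a at_ gE] := @mvt_line g dg t t0.
  move=> r rt; apply: is_deriveB; apply: is_derive_line.
    by rewrite addrAC; exact: (df r t rt tt).1.
  by have := (df r 0 rt z0).1; rewrite scale0r addr0.
pose k (r : R) := fv (u + a *: v + r *: w).
have [|b bt kE] := @mvt_line k (fun r => fwv (u + a *: v + r *: w)) t t0.
  by move=> r rt; apply: is_derive_line; exact: (df a r at_ rt).2.
exists a, b; split => //; transitivity (g t - g 0).
  by rewrite /g !scale0r !addr0 [u + t *: w + _]addrAC opprB [RHS]addrA [RHS]addrAC.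
rewrite gE /dg [u + t *: w + _]addrAC expr2 -mulrA -kE /k scale0r addr0.
by [].
Qed.

(** The second difference is symmetric in v and w, so both mixed derivatives are
    approximated by the same number. *)
Lemma schwarz f fv fw fwv fvw (U : set V) u v w : open U -> U u ->
  (forall x, U x -> is_derive x v f (fv x) /\ is_derive x w fv (fwv x)) ->
  (forall x, U x -> is_derive x w f (fw x) /\ is_derive x v fw (fvw x)) ->
  {for u, continuous fwv} -> {for u, continuous fvw} ->
  fwv u = fvw u.
Proof.
move=> oU Uu dvw dwv cwv cvw; apply/eqP; rewrite -subr_eq0 -normr_le0.
apply/ler_addgt0Pl => e e0; rewrite addr0.
have near_small (P : V -> Prop) : (\forall x \near u, P x) ->
    exists2 t0 : R, 0 < t0 & forall t a b : R, 0 <= t < t0 -> 0 <= a <= t -> 0 <= b <= t ->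
      P (u + a *: v + b *: w).
  move=> /nbhs_ballP[d /= d0 dP]; exists (d / (`|v| + `|w| + 1)).
    by rewrite divr_gt0 // ltr_wpDl // addr_ge0.
  move=> t a b /andP[t0]; rewrite ltr_pdivlMr; last by rewrite ltr_wpDl // addr_ge0.
  move=> td /andP[a0 at_] /andP[b0 bt]; apply: dP; rewrite -ball_normE /=.
  rewrite opprD addrA opprD addrA subrr sub0r -opprD normrN.
  apply: le_lt_trans (ler_normD _ _) _; rewrite !normrZ !ger0_norm //.
  apply: le_lt_trans td; rewrite !mulrDr mulr1 -[leLHS]addr0 lerD // lerD //;
  exact: ler_wpM2r.
have /near_small[t1 t10 t1P] : \forall x \near u, U x by exact: open_nbhs_nbhs.
have e20 : 0 < e / 2 by rewrite divr_gt0.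
move/cvgrPdist_lt/(_ _ e20)/near_small : cwv => [t2 t20 t2P].
move/cvgrPdist_lt/(_ _ e20)/near_small : cvw => [t3 t30 t3P].
have [t [t0 tt1 tt2 tt3]] : exists t, [/\ 0 < t, t < t1, t < t2 & t < t3].
  (* half the minimum makes all three bounds strict *)
  pose m := Num.min t1 (Num.min t2 t3).
  have m0 : 0 < m by rewrite !lt_min t10 t20 t30.
  have : m / 2 < m by move: m0; clear; lra.
  rewrite {2}/m !lt_min => /and3P[? ? ?].
  by exists (m / 2); split => //; rewrite divr_gt0.
have t0' := ltW t0.
have [|a [b [at_ bt eq1]]] := @mixed_difference f fv fwv u v w t t0.
  by move=> a b a0 b0; apply: dvw; apply: t1P a0 b0; rewrite t0'.
have [|b' [a' [bt' at' eq2]]] := @mixed_difference f fw fvw u w v t t0.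
  by move=> c d c0 d0; apply: dwv; rewrite addrAC; apply: t1P d0 c0; rewrite t0'.
have d1 : `|fwv u - fwv (u + a *: v + b *: w)| < e / 2.
  by apply: t2P at_ bt; rewrite t0'.
have d2 : `|fvw u - fvw (u + b' *: w + a' *: v)| < e / 2.
  by rewrite addrAC; apply: t3P at' bt'; rewrite t0'.
have AB : fwv (u + a *: v + b *: w) = fvw (u + b' *: w + a' *: v).
  apply: (@mulfI _ (t ^+ 2)); first by rewrite sqrf_eq0 gt_eqF.
  rewrite -eq1 -eq2 [u + t *: w + _]addrAC; congr (_ + _); exact: addrAC.
rewrite -AB in d2; apply: le_trans (ler_distD (fwv (u + a *: v + b *: w)) _ _) _.
by rewrite (splitr e) lerD // ltW // distrC.
Qed.

End Schwarz.

Section SmoothMaps.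
Variables (R : realType) (V W : normedModType R).
Implicit Types (f : V -> W) (U : set V).

Lemma smooth_on_derive U f v : smooth_on U f -> smooth_on U ('D_v f).
Proof. by move=> sf k; apply: (sf k.+1).2. Qed.

Lemma smooth_on_differentiable U f x : smooth_on U f -> U x -> differentiable f x.
Proof. by move=> sf; apply: (sf 1).1. Qed.

Lemma smooth_on_continuous U f x :
  smooth_on U f -> U x -> {for x, continuous f}.
Proof. by move=> sf; apply: (sf 0). Qed.
End SmoothMaps.

Section Coordinates.
Variables (R : realType) (V : normedModType R) (m : nat).
Implicit Types (f g : V -> 'rV[R]_m) (u v w : V).

Lemma is_derive_coord f u v i : differentiable f u ->
  is_derive u v (fun x => f x ord0 i) ('D_v f u ord0 i).
Proof.
move=> /(diff_derivable (v:=v)) df; rewrite derive_mx // mxE.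
by apply: derivableP; exact: (derivable_mxP f u v).1.
Qed.

Lemma is_derive_dot f g u v : differentiable f u -> differentiable g u ->
  is_derive u v (fun x => dot (f x) (g x))
    (dot ('D_v f u) (g u) + dot (f u) ('D_v g u)).
Proof.
move=> df dg; rewrite /dot -big_split /=.
have -> : (fun x => \sum_i f x ord0 i * g x ord0 i) =
    \sum_i ((fun x => f x ord0 i) * (fun x => g x ord0 i)).
  by apply/funext => x; rewrite fct_sumE.
apply: is_derive_sum => i.
have := is_deriveM (is_derive_coord v i df) (is_derive_coord v i dg).
by move=> h; apply: (is_derive_eq h); rewrite addrC; congr (_ + _); apply: mulrC.
Qed.

Lemma schwarz_smooth f (U : set V) u v w : open U -> smooth_on U f -> U u ->
  'D_w ('D_v f) u = 'D_v ('D_w f) u.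
Proof.
move=> oU sf Uu; apply/rowP => i.
have c2 a b : {for u, continuous (fun x => 'D_a ('D_b f) x ord0 i)}.
  apply: (@continuous_comp _ _ _ ('D_a ('D_b f)) (fun M : 'rV_m => M ord0 i)).
    by apply: smooth_on_continuous Uu; do 2!apply: smooth_on_derive.
  exact: coord_continuous.
have d2 a b x : U x ->
    is_derive x a (fun y => f y ord0 i) ('D_a f x ord0 i) /\
    is_derive x b (fun y => 'D_a f y ord0 i) ('D_b ('D_a f) x ord0 i).
  move=> Ux; split; apply: is_derive_coord.
    exact: smooth_on_differentiable Ux.
  by apply: smooth_on_differentiable Ux; apply: smooth_on_derive.
exact: (schwarz oU Uu (d2 v w) (d2 w v) (c2 w v) (c2 v w)).
Qed.

End Coordinates.

Lemma is_derive_proj (R : realType) n (z w : 'rV[R]_n) i :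
  is_derive z w (fun x : 'rV[R]_n => x ord0 i) (w ord0 i).
Proof.
have did : differentiable (@id 'rV[R]_n) z by exact: ex_diff.
by have := is_derive_coord w i did; rewrite derive_id.
Qed.

Section Ck.
Variables (R : realType) (V : normedModType R).

Lemma Ck_on_le (W : normedModType R) (U : set V) k (f : V -> W) :
  Ck_on k.+1 U f -> Ck_on k U f.
Proof.
elim: k f => [|k IHk] f [df Df].
  by move=> x Ux; apply: differentiable_continuous; exact: df.
by split=> // v; apply: IHk; exact: Df.
Qed.

Lemma Ck_on_subset (W : normedModType R) (U U' : set V) k (f : V -> W) :
  U `<=` U' -> Ck_on k U' f -> Ck_on k U f.
Proof.
move=> UU'; elim: k f => [|k IHk] f /=; first by move=> cf x /UU'; exact: cf.
by move=> [df Df]; split=> [x /UU'|v]; [exact: df|apply: IHk; exact: Df].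
Qed.

Lemma Ck_cst (W : normedModType R) k (a : W) : Ck_on k [set: V] (cst a).
Proof.
elim: k a => [|k IHk] a /=; first by move=> x _; exact: cst_continuous.
split=> [x _|v]; first exact: differentiable_cst.
have -> : 'D_v (cst a) = cst 0 :> (V -> W).
  by apply/funext => x; rewrite derive_cst.
exact: IHk.
Qed.

Lemma Ck_linear (W : normedModType R) k (f : {linear V -> W}) :
  continuous f -> Ck_on k [set: V] f.
Proof.
move=> cf; case: k => [|k] /=; first by move=> x _; exact: cf.
have df x : differentiable f x by exact: linear_differentiable.
split=> [x _|v]; first exact: df.
have -> : 'D_v f = cst (f v) by apply/funext => x; rewrite deriveE // diff_lin.
exact: Ck_cst.
Qed.

Lemma CkD (W : normedModType R) k (f g : V -> W) :
  Ck_on k [set: V] f -> Ck_on k [set: V] g -> Ck_on k [set: V] (f + g).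
Proof.
elim: k f g => [|k IHk] f g /=.
  by move=> cf cg x xT; apply: continuousD; [exact: cf|exact: cg].
move=> [df Df] [dg Dg]; split=> [x _|v].
  by apply: differentiableD; [exact: df|exact: dg].
have -> : 'D_v (f + g) = 'D_v f + 'D_v g.
  by apply/funext => x; rewrite deriveD //; apply: diff_derivable; [exact: df|exact: dg].
by apply: IHk; [exact: Df|exact: Dg].
Qed.

Lemma CkZl (W : normedModType R) k (f : V -> R) (a : W) :
  Ck_on k [set: V] f -> Ck_on k [set: V] (fun x => f x *: a).
Proof.
elim: k f => [|k IHk] f /=.
  by move=> cf x xT; apply: continuousZr_tmp; exact: cf.
move=> [df Df]; split=> [x _|v]; first by apply: differentiableZl; exact: df.
have -> : 'D_v (fun x => f x *: a) = fun x => 'D_v f x *: a.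
  apply/funext => x; rewrite deriveE; last by apply: differentiableZl; exact: df.
  by rewrite diffZl ?deriveE //; exact: df.
by apply: IHk; exact: Df.
Qed.

Lemma CkM k (f g : V -> R) :
  Ck_on k [set: V] f -> Ck_on k [set: V] g -> Ck_on k [set: V] (f * g).
Proof.
elim: k f g => [|k IHk] f g.
  by move=> cf cg x xT; apply: continuousM; [exact: cf|exact: cg].
move=> Cf Cg; have [df Df] := Cf; have [dg Dg] := Cg; split=> [x _|v].
  by apply: differentiableM; [exact: df|exact: dg].
have -> : 'D_v (f * g) = f * 'D_v g + g * 'D_v f.
  by apply/funext => x; rewrite deriveM //; apply: diff_derivable; [exact: df|exact: dg].
by apply: CkD; apply: IHk; [exact: Ck_on_le|exact: Dg|exact: Ck_on_le|exact: Df].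
Qed.

Lemma CkX k (f : V -> R) n : Ck_on k [set: V] f -> Ck_on k [set: V] (f ^+ n).
Proof.
move=> Cf; elim: n => [|n IHn]; first exact: (Ck_cst k (1 : R)).
by rewrite exprS; exact: CkM.
Qed.

Lemma CkN k (f : V -> R) : Ck_on k [set: V] f -> Ck_on k [set: V] (- f).
Proof.
by move=> Cf; rewrite -mulN1r; apply: CkM => //; exact: (Ck_cst k (-1 : R)).
Qed.

End Ck.

(** * Curvature of immersed hypersurfaces *)

Section Dot.
Variable R : realType.

Lemma dotE n (u v : 'rV[R]_n) : dot u v = (u *m v^T) ord0 ord0.
Proof. by rewrite mxE /dot; apply: eq_bigr => i _; rewrite mxE. Qed.

Lemma dotC n (u v : 'rV[R]_n) : dot u v = dot v u.
Proof. by rewrite /dot; apply: eq_bigr => i _; rewrite mulrC. Qed.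

Lemma dotDl n (u v w : 'rV[R]_n) : dot (u + v) w = dot u w + dot v w.
Proof. by rewrite !dotE mulmxDl mxE. Qed.

Lemma dotZl n c (u v : 'rV[R]_n) : dot (c *: u) v = c * dot u v.
Proof. by rewrite !dotE -scalemxAl mxE. Qed.

Lemma dotBl n (u v w : 'rV[R]_n) : dot (u - v) w = dot u w - dot v w.
Proof. by rewrite -scaleN1r dotDl dotZl mulN1r. Qed.

Lemma dot_suml n (I : finType) (f : I -> 'rV[R]_n) v :
  dot (\sum_i f i) v = \sum_i dot (f i) v.
Proof. by rewrite dotE mulmx_suml summxE; apply: eq_bigr => i _; rewrite dotE. Qed.

Lemma dot_ge0 n (u : 'rV[R]_n) : 0 <= dot u u.
Proof. by apply: sumr_ge0 => i _; rewrite -expr2 sqr_ge0. Qed.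

Lemma dot_eq0 n (u : 'rV[R]_n) : (dot u u == 0) = (u == 0).
Proof.
apply/idP/eqP => [|->]; last by rewrite dotE mul0mx mxE.
rewrite psumr_eq0 => [/allP u0|i _]; last by rewrite -expr2 sqr_ge0.
apply/rowP => i; rewrite mxE; apply/eqP; rewrite -sqrf_eq0 expr2.
by have := u0 i; rewrite mem_index_enum => /(_ isT).
Qed.

Definition qform n (S : 'M[R]_n) (a b : 'rV[R]_n) : R :=
  \sum_i \sum_j a ord0 i * S i j * b ord0 j.

Lemma qformE n (S : 'M[R]_n) a b : qform S a b = dot (a *m S) b.
Proof.
rewrite /qform exchange_big /=; apply: eq_bigr => j _.
by rewrite mxE mulr_suml.
Qed.

Lemma qform_sym n (S : 'M[R]_n) a b : S^T = S -> qform S a b = qform S b a.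
Proof.
move=> sS; rewrite /qform exchange_big; apply: eq_bigr => j _; apply: eq_bigr => i _.
by rewrite -[in RHS]sS mxE; ring.
Qed.

(** The strict inequality comes from the value of the form at
    a - (S(a, b) / S(b, b)) b, which is nonzero for independent a and b. *)
Lemma cauchy_schwarz n (S : 'M[R]_n) a b : S^T = S ->
  (forall c, c != 0 -> 0 < qform S c c) -> free [:: a; b] ->
  0 < qform S a a * qform S b b - qform S a b ^+ 2.
Proof.
move=> sS pS; rewrite free_cons seq1_free span_seq1 => /andP[ab /pS b0].
pose t := qform S a b / qform S b b.
have : a - t *: b != 0.
  by apply: contraNneq ab => /subr0_eq ->; apply/vlineP; exists t.
move/pS; rewrite qformE mulmxBl -scalemxAl dotBl dotZl dotC dotBl dotZl.
rewrite [X in _ - t * X]dotC dotBl dotZl ![dot a _]dotC ![dot b _]dotC -!qformE.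
rewrite [qform S b a]qform_sym // => h; rewrite -(pmulr_rgt0 _ b0) in h.
by apply: lt_le_trans h _; rewrite le_eqVlt; apply/orP; left; apply/eqP;
  rewrite /t; field; rewrite gt_eqF.
Qed.

(** The rows of M span a hyperplane, so its orthogonal complement is a line. *)
Lemma orthogonal_line n (M : 'M[R]_(n, n.+1)) (nu v : 'rV[R]_n.+1) :
  row_free M -> nu != 0 -> nu *m M^T = 0 -> v *m M^T = 0 ->
  v = (dot nu v / dot nu nu) *: nu.
Proof.
move=> fM nu0 nuM vM.
have rk : \rank (kermx M^T) = 1%N.
  by rewrite mxrank_ker mxrank_tr (eqP fM) subSnn.
have nuk : (nu <= kermx M^T)%MS by apply/sub_kermxP.
have vnu : (v <= nu)%MS.
  apply: (@submx_trans _ _ _ _ _ _ (kermx M^T)); first exact/sub_kermxP.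
  have := (mxrank_leqif_eq nuk).2; rewrite rk rank_rV nu0 eqxx.
  by move=> /esym/andP[].
case/sub_rVP: vnu => k ->; rewrite dotC dotZl mulfK //.
by rewrite dot_eq0.
Qed.

End Dot.

Section DerivableOps.
Variables (R : realType) (V : normedModType R).
Implicit Types x v : V.

Lemma derivable_bigsum (I : Type) (r : seq I) (P : pred I) (f : I -> V -> R) x v :
  (forall i, P i -> derivable (f i) x v) ->
  derivable (fun y => \sum_(i <- r | P i) f i y) x v.
Proof.
move=> df; elim: r => [|i r IHr].
  by under eq_fun do rewrite big_nil; exact: derivable_cst.
under eq_fun do rewrite big_cons.
case: (P i) (df i) => [/(_ isT) dfi|_]; [exact: (derivableD dfi IHr)|exact: IHr].
Qed.

Lemma derivable_bigprod (I : Type) (r : seq I) (P : pred I) (f : I -> V -> R) x v :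
  (forall i, P i -> derivable (f i) x v) ->
  derivable (fun y => \prod_(i <- r | P i) f i y) x v.
Proof.
move=> df; elim: r => [|i r IHr].
  by under eq_fun do rewrite big_nil; exact: derivable_cst.
under eq_fun do rewrite big_cons.
case: (P i) (df i) => [/(_ isT) dfi|_]; [exact: (derivableM dfi IHr)|exact: IHr].
Qed.

Lemma derivable_det n (A : V -> 'M[R]_n) x v :
  (forall i j, derivable (fun y => A y i j) x v) ->
  derivable (fun y => \det (A y)) x v.
Proof.
move=> dA; apply: derivable_bigsum => s _.
apply: (@derivableM _ _ (cst _)); first exact: derivable_cst.
exact: derivable_bigprod.
Qed.

(** Cramer's rule reduces this to polynomials in the coefficients. *)
Lemma derivable_invmx n (A : V -> 'M[R]_n) x v :
  (\forall y \near x, A y \in unitmx) ->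
  (forall i j, derivable (fun y => A y i j) x v) ->
  forall i j, derivable (fun y => invmx (A y) i j) x v.
Proof.
move=> uA dA i j.
have dinv : derivable (fun y => (\det (A y))^-1 * \adj (A y) i j) x v.
  apply: (@derivableM _ _ (fun y => (\det (A y))^-1)).
    apply: derivableV; last exact: derivable_det.
    by have := nbhs_singleton uA; rewrite unitmxE unitfE.
  under eq_fun do rewrite mxE /cofactor.
  apply: (@derivableM _ _ (cst _)); first exact: derivable_cst.
  apply: derivable_det => k l; under eq_fun do rewrite !mxE; exact: dA.
apply: near_eq_derivable dinv.
near=> y; rewrite /invmx ifT ?mxE //; near: y; exact: uA.
Unshelve. all: by end_near. Qed.

End DerivableOps.

Section GaussEquation.
Variables (R : realType) (n : nat) (U : set 'rV[R]_n) (g : 'rV[R]_n -> 'M[R]_n).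
Variables (X : 'I_n -> 'rV[R]_n -> 'rV[R]_n.+1).
Variables (X2 : 'I_n -> 'I_n -> 'rV[R]_n -> 'rV[R]_n.+1).
Variables (X3 : 'I_n -> 'I_n -> 'I_n -> 'rV[R]_n -> 'rV[R]_n.+1).
Local Notation e i := (basis_vec R i).
Hypothesis oU : open U.
Hypothesis gE : forall x i j, g x i j = dot (X i x) (X j x).
Hypothesis g_unit : forall x, U x -> g x \in unitmx.
Hypothesis X2C : forall x i j, U x -> X2 i j x = X2 j i x.
Hypothesis X3C : forall x i j k, U x -> X3 i j k x = X3 j i k x.
Hypothesis dg : forall x i j l, U x -> is_derive x (e i) (fun y => g y j l)
    (dot (X2 i j x) (X l x) + dot (X j x) (X2 i l x)).
Hypothesis dX2X : forall x i j k s, U x ->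
  is_derive x (e i) (fun y => dot (X2 j k y) (X s y))
    (dot (X3 i j k x) (X s x) + dot (X2 j k x) (X2 i s x)).
Local Notation Gam := (christoffel g).

Lemma metric_tr x : (g x)^T = g x.
Proof. by apply/matrixP => i j; rewrite mxE !gE dotC. Qed.

(** The three derivatives of the metric in the definition combine, by the symmetry
    of second derivatives, into the tangential part of X_ij. *)
Lemma christoffelE x k i j : U x ->
  Gam k i j x = \sum_l invmx (g x) k l * dot (X2 i j x) (X l x).
Proof.
move=> Ux; rewrite /christoffel mulr_sumr; apply: eq_bigr => l _.
rewrite (@derive_val _ _ _ _ _ _ _ (dg i j l Ux)).
rewrite (@derive_val _ _ _ _ _ _ _ (dg j i l Ux)).
rewrite (@derive_val _ _ _ _ _ _ _ (dg l i j Ux)).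
rewrite (X2C j i Ux) (X2C l i Ux) (X2C l j Ux) [dot (X j x) _]dotC [dot (X i x) _]dotC.
by field.
Qed.

Lemma christoffel_metric x s i j : U x ->
  \sum_l Gam l i j x * g x l s = dot (X2 i j x) (X s x).
Proof.
move=> Ux; pose d := \row_l dot (X2 i j x) (X l x).
transitivity ((d *m (invmx (g x))^T *m g x) ord0 s).
  rewrite mxE; apply: eq_bigr => l _; congr (_ * _); rewrite christoffelE // mxE.
  by apply: eq_bigr => m _; rewrite !mxE mulrC.
by rewrite trmx_inv metric_tr mulmxKV ?g_unit // mxE.
Qed.

(** The derivatives occurring in the Riemann tensor must be shown to exist before
    the product rule can be used on them. *)
Lemma derivable_christoffel x i l j k : U x -> derivable (Gam l j k) x (e i).
Proof.
move=> Ux; have nU : \forall y \near x, U y by exact: open_nbhs_nbhs.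
have : derivable (fun y => \sum_m invmx (g y) l m * dot (X2 j k y) (X m y)) x (e i).
  apply: derivable_bigsum => m _; apply: derivableM.
    apply: derivable_invmx => [|a b]; first by near do apply: g_unit.
    exact: (@ex_derive _ _ _ _ _ _ _ (dg i a b Ux)).
  exact: (@ex_derive _ _ _ _ _ _ _ (dX2X i j k m Ux)).
apply: near_eq_derivable; near=> y; rewrite christoffelE //; near: y; exact: nU.
Unshelve. all: by end_near. Qed.

(** The second fundamental form, as a normal vector: the Christoffel symbols are
    the coefficients of the tangential part of X_jk ([normal_part_orth]). *)
Definition normal_part x j k : 'rV[R]_n.+1 :=
  X2 j k x - \sum_l Gam l j k x *: X l x.

Lemma normal_part_orth x j k s : U x -> dot (normal_part x j k) (X s x) = 0.
Proof.
move=> Ux; rewrite dotBl dot_suml -christoffel_metric //.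
apply/eqP; rewrite subr_eq0; apply/eqP; apply: eq_bigr => l _.
by rewrite dotZl gE.
Qed.

Lemma derive_christoffel_metric x i j k s : U x ->
  \sum_l 'D_(e i) (Gam l j k) x * g x l s =
  dot (X3 i j k x) (X s x) + dot (X2 j k x) (X2 i s x)
  - \sum_l Gam l j k x * (dot (X2 i l x) (X s x) + dot (X l x) (X2 i s x)).
Proof.
move=> Ux; have nU : \forall y \near x, U y by exact: open_nbhs_nbhs.
have dl l : is_derive x (e i) ((Gam l j k) * (fun y => g y l s))
    (Gam l j k x * (dot (X2 i l x) (X s x) + dot (X l x) (X2 i s x))
     + g x l s * 'D_(e i) (Gam l j k) x).
  have h := is_deriveM (derivableP (@derivable_christoffel x i l j k Ux)) (dg i l s Ux).
  exact: (is_derive_eq h).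
have ds := is_derive_sum dl.
have : is_derive x (e i) (\sum_l Gam l j k * (fun y => g y l s))
    (dot (X3 i j k x) (X s x) + dot (X2 j k x) (X2 i s x)).
  apply: near_eq_is_derive (dX2X i j k s Ux); near=> y.
  rewrite fct_sumE -christoffel_metric //; near: y; exact: nU.
move=> /(@derive_val _ _ _ _ _ _ _) <-.
rewrite (@derive_val _ _ _ _ _ _ _ ds) big_split /= [RHS]addrAC subrr add0r.
by apply: eq_bigr => l _; rewrite mulrC.
Unshelve. all: by end_near. Qed.

(** Lowering the index of the Riemann tensor avoids any derivative of the inverse
    metric: one differentiates the products of the X_jk and the X_s instead.  The third
    derivatives cancel by symmetry. *)
Lemma gauss_equation x i j k s : U x ->
  \sum_l riemann g l i j k x * g x l s =
  dot (normal_part x j k) (X2 i s x) - dot (normal_part x i k) (X2 j s x).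
Proof.
move=> Ux.
have quad a b : \sum_l (\sum_m Gam l a m x * Gam m b k x) * g x l s =
    \sum_l Gam l b k x * dot (X2 a l x) (X s x).
  under eq_bigr do rewrite mulr_suml.
  rewrite exchange_big /=; apply: eq_bigr => m _.
  by rewrite -christoffel_metric // mulr_sumr; apply: eq_bigr => l _; ring.
have [D DE] : exists D, forall a b l, 'D_(e a) (Gam l b k) x = D a b l.
  by exists (fun a b l => 'D_(e a) (Gam l b k) x).
have half a b : \sum_l D a b l * g x l s =
    dot (X3 a b k x) (X s x) + dot (normal_part x b k) (X2 a s x)
    - \sum_l (\sum_m Gam l a m x * Gam m b k x) * g x l s.
  under eq_bigr do rewrite -DE.
  rewrite derive_christoffel_metric // quad dotBl dot_suml -!addrA; congr (_ + _).
  congr (_ + _); rewrite -opprD -big_split /=; congr (- _); apply: eq_bigr => l _.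
  by rewrite dotZl; ring.
transitivity (\sum_l D i j l * g x l s - \sum_l D j i l * g x l s +
    (\sum_l (\sum_m Gam l i m x * Gam m j k x) * g x l s -
     \sum_l (\sum_m Gam l j m x * Gam m i k x) * g x l s)).
  rewrite -!sumrB -big_split; apply: eq_bigr => l _.
  by rewrite /riemann (DE i j l) (DE j i l) sumrB mulrDl !mulrBl.
have cancel (a n1 n2 s1 s2 : R) :
  a + n1 - s1 - (a + n2 - s2) + (s1 - s2) = n1 - n2 by ring.
by rewrite (half i j) (half j i) (X3C i j k Ux) cancel.
Qed.

(** In codimension one all normal parts are multiples of nu, so the Gauss equation
    becomes a difference of products of the scalar form S. *)
Lemma curvature_numerator x (nu : 'rV[R]_n.+1) (S : 'M[R]_n) a b : U x ->
  row_free (\matrix_(i, j) X i x ord0 j) -> nu != 0 ->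
  (forall i, dot nu (X i x) = 0) -> (forall i j, S i j = - dot nu (X2 i j x)) ->
  inner g x (curvature_op g x a b) a =
  (dot nu nu)^-1 * (qform S a a * qform S b b - qform S a b ^+ 2).
Proof.
move=> Ux; set M := matrix_of_fun _ _ => fM nu0 nuX SE.
pose N j k := normal_part x j k.
have NE j k : N j k = (- S j k / dot nu nu) *: nu.
  have orth v : (forall s, dot v (X s x) = 0) -> v *m M^T = 0.
    move=> vX; apply/rowP => s; rewrite [RHS]mxE -(vX s) dotE !mxE.
    by apply: eq_bigr => l _; rewrite !mxE.
  rewrite [LHS](@orthogonal_line _ _ M nu) //.
  - rewrite SE opprK dotC dotBl dot_suml big1 ?subr0 1?dotC // => l _.
    by rewrite dotZl dotC nuX mulr0.
  - exact: orth.
  - by apply: orth => s; apply: normal_part_orth.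
have riemannE i j k s : \sum_l riemann g l i j k x *
    g x l s = (dot nu nu)^-1 * (S j k * S i s - S i k * S j s).
  rewrite gauss_equation // -/(N j k) -/(N i k) !NE.
  by rewrite !dotZl -[dot nu (X2 i s x)]opprK -[dot nu (X2 j s x)]opprK -!SE; ring.
have Ssym : S^T = S by apply/matrixP => i j; rewrite mxE !SE X2C.
transitivity (\sum_s \sum_i \sum_j \sum_k
  a ord0 i * b ord0 j * b ord0 k * a ord0 s *
  \sum_l riemann g l i j k x * g x l s).
  rewrite /inner exchange_big; apply: eq_bigr => s _ /=.
  transitivity (\sum_l \sum_i \sum_j \sum_k a ord0 i * b ord0 j * b ord0 k *
    a ord0 s * (riemann g l i j k x * g x l s)).
    apply: eq_bigr => l _; rewrite mxE -mulrA mulr_suml; apply: eq_bigr => i _.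
    rewrite mulr_suml; apply: eq_bigr => j _; rewrite mulr_suml.
    apply: eq_bigr => k _.
    by rewrite -!mulrA; do 3!congr (_ * _); rewrite mulrA mulrC.
  rewrite exchange_big; apply: eq_bigr => i _; rewrite exchange_big.
  apply: eq_bigr => j _; rewrite exchange_big; apply: eq_bigr => k _.
  by rewrite mulr_sumr.
transitivity (\sum_s \sum_i (dot nu nu)^-1 *
  (a ord0 i * S i s * a ord0 s * qform S b b -
   (\sum_k a ord0 i * S i k * b ord0 k) * (\sum_j b ord0 j * S j s * a ord0 s))).
  apply: eq_bigr => s _; apply: eq_bigr => i _.
  rewrite big_distrlr [X in _ - X]exchange_big /= /qform mulr_sumr -sumrB mulr_sumr.
  apply: eq_bigr => j _; rewrite mulr_sumr -sumrB mulr_sumr; apply: eq_bigr => k _.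
  by rewrite riemannE; ring.
have qba : qform S b a = \sum_s \sum_j b ord0 j * S j s * a ord0 s by exact: exchange_big.
rewrite expr2 {2}(qform_sym a b Ssym) qba mulrBr.
under eq_bigr do rewrite -mulr_sumr sumrB.
rewrite -mulr_sumr sumrB mulrBr; congr (_ * _ - _ * _).
  by rewrite /qform [in RHS]exchange_big mulr_suml; apply: eq_bigr => s _; rewrite mulr_suml.
by rewrite mulr_sumr; apply: eq_bigr => s _; rewrite /qform mulr_suml.
Qed.

End GaussEquation.

Section Frame.
Variables (R : realType) (n m : nat) (phi : 'rV[R]_n -> 'rV[R]_m) (u : 'rV[R]_n).
Hypotheses (dphi : differentiable phi u)
  (iphi : injective ('d phi u : 'rV[R]_n -> 'rV[R]_m)).

Definition frame : 'M[R]_(n, m) :=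
  \matrix_(i, j) 'D_(basis_vec R i) phi u ord0 j.

Lemma row_frame i : row i frame = 'D_(basis_vec R i) phi u.
Proof. by apply/rowP => j; rewrite !mxE. Qed.

Lemma mul_frame c : c *m frame = 'D_c phi u.
Proof.
rewrite deriveE // mulmx_sum_row [in RHS](row_sum_delta c) linear_sum.
by apply: eq_bigr => i _; rewrite linearZ row_frame deriveE.
Qed.

Lemma derive_sum_basis c :
  'D_c phi u = \sum_i c ord0 i *: 'D_(basis_vec R i) phi u.
Proof.
by rewrite -mul_frame mulmx_sum_row; apply: eq_bigr => i _; rewrite row_frame.
Qed.

Lemma frame_free : row_free frame.
Proof.
apply: inj_row_free => c; rewrite mul_frame deriveE // => c0.
by apply: iphi; rewrite linear0.
Qed.

Lemma induced_metricE : induced_metric phi u = frame *m frame^T.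
Proof.
by apply/matrixP => i j; rewrite !mxE; apply: eq_bigr => k _; rewrite !mxE.
Qed.

Lemma qform_metric c : qform (induced_metric phi u) c c = dot (c *m frame) (c *m frame).
Proof.
by rewrite qformE induced_metricE !dotE trmx_mul !mulmxA.
Qed.

Lemma induced_metric_gt0 c : c != 0 -> 0 < qform (induced_metric phi u) c c.
Proof.
move=> c0; rewrite qform_metric lt_def dot_ge0 andbT dot_eq0.
apply: contraNneq c0 => /eqP; rewrite -(mul0mx _ frame).
by rewrite (inj_eq (row_free_inj frame_free)).
Qed.

Lemma induced_metric_unit : induced_metric phi u \in unitmx.
Proof.
rewrite -row_free_unit; apply: inj_row_free => c c0.
apply/eqP; apply: contraTT isT => /induced_metric_gt0.
by rewrite qformE c0 dotE mul0mx mxE ltxx.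
Qed.

End Frame.

(** A level set whose defining function has a positive definite tangential
    Hessian is used with nu its gradient: the matrix below is then that Hessian in
    the frame of phi. *)
Theorem sectional_curvature_gt0 (R : realType) (n : nat)
    (phi : 'rV[R]_n -> 'rV[R]_n.+1) U u (nu : 'rV[R]_n.+1) a b :
  open U -> smooth_on U phi ->
  (forall x, U x -> injective ('d phi x : 'rV[R]_n -> 'rV[R]_n.+1)) ->
  U u -> nu != 0 -> (forall i, dot nu ('D_(basis_vec R i) phi u) = 0) ->
  (forall c, c != 0 -> 0 < qform (\matrix_(i, j)
     - dot nu ('D_(basis_vec R i) ('D_(basis_vec R j) phi) u)) c c) ->
  free [:: a; b] ->
  0 < sectional_curvature (induced_metric phi) u a b.
Proof.
move=> oU sphi iphi Uu nu0 nuX; set S := matrix_of_fun _ _ => Spos fab.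
have dphi x : U x -> differentiable phi x by exact: smooth_on_differentiable.
pose X i := 'D_(basis_vec R i) phi.
pose X2 i j := 'D_(basis_vec R i) (X j).
pose X3 i j k := 'D_(basis_vec R i) (X2 j k).
have sX i : smooth_on U (X i) by exact: smooth_on_derive.
have sX2 i j : smooth_on U (X2 i j) by exact: smooth_on_derive.
have dX i x : U x -> differentiable (X i) x by exact: smooth_on_differentiable.
have dX2 i j x : U x -> differentiable (X2 i j) x by exact: smooth_on_differentiable.
have gE x i j : induced_metric phi x i j = dot (X i x) (X j x) by rewrite mxE.
have gunit x : U x -> induced_metric phi x \in unitmx.
  by move=> Ux; apply: induced_metric_unit; [exact: dphi|exact: iphi].
have X2C x i j : U x -> X2 i j x = X2 j i x by exact: schwarz_smooth.
have X3C x i j k : U x -> X3 i j k x = X3 j i k x by exact: schwarz_smooth.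
have dg x i j l : U x -> is_derive x (basis_vec R i)
    (fun y => induced_metric phi y j l)
    (dot (X2 i j x) (X l x) + dot (X j x) (X2 i l x)).
  move=> Ux; have -> : (fun y => induced_metric phi y j l) =
    (fun y => dot (X j y) (X l y)) by apply/funext => y; rewrite mxE.
  by apply: is_derive_dot; exact: dX.
have dX2X x i j k s : U x -> is_derive x (basis_vec R i)
    (fun y => dot (X2 j k y) (X s y))
    (dot (X3 i j k x) (X s x) + dot (X2 j k x) (X2 i s x)).
  by move=> Ux; apply: is_derive_dot; [exact: dX2|exact: dX].
have SE i j : S i j = - dot nu (X2 i j u) by rewrite mxE.

have Ssym : S^T = S by apply/matrixP => i j; rewrite mxE !SE (X2C _ _ _ Uu).
rewrite /sectional_curvature divr_gt0 //; last first.
  apply: (cauchy_schwarz (metric_tr gE u)) => // c c0.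
  by apply: induced_metric_gt0; [exact: dphi|exact: iphi|].
rewrite (curvature_numerator oU gE gunit X2C X3C dg dX2X _ _ Uu _ nu0 nuX SE).
  rewrite mulr_gt0 ?invr_gt0 ?cauchy_schwarz //.
  by rewrite lt_def dot_ge0 dot_eq0 nu0.
by apply: frame_free; [exact: dphi|exact: iphi].
Qed.

(** * The sheared Hamiltonian in scalar coordinates *)

Section Scalars.
Variable R : realType.
Implicit Types y x e w u : R.

Definition pot x1 x2 : R :=
  2 * (x1 ^+ 2 + x2 ^+ 2) * (2 - 3 * (x1 ^+ 2 - x2 ^+ 2) ^+ 2).

(** The first derivative of [pot] in its first argument; by symmetry the other one
    is obtained by exchanging the arguments. *)
Definition pot1 x1 x2 : R :=
  4 * x1 * (2 - 3 * (x1 ^+ 2 - x2 ^+ 2) ^+ 2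
            - 6 * (x1 ^+ 2 + x2 ^+ 2) * (x1 ^+ 2 - x2 ^+ 2)).
Definition pot11 x1 x2 : R :=
  4 * (2 - 3 * (x1 ^+ 2 - x2 ^+ 2) ^+ 2
            - 6 * (x1 ^+ 2 + x2 ^+ 2) * (x1 ^+ 2 - x2 ^+ 2))
  - 48 * x1 ^+ 2 * (3 * x1 ^+ 2 - x2 ^+ 2).
Definition pot12 x1 x2 : R := 48 * x1 * x2 * (x1 ^+ 2 + x2 ^+ 2).

(** In [dkhat] and [hkhat] the last arguments are the components of the tangent
    vectors. *)
Definition khat y1 y2 x1 x2 : R :=
  2^-1 * (y1 - 8 / 3 * x2 ^+ 3) ^+ 2 + 2^-1 * (y2 + 8 / 3 * x1 ^+ 3) ^+ 2
  + pot x1 x2.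
Definition dkhat y1 y2 x1 x2 e1 e2 w1 w2 : R :=
  (y1 - 8 / 3 * x2 ^+ 3) * (e1 - 8 * x2 ^+ 2 * w2)
  + (y2 + 8 / 3 * x1 ^+ 3) * (e2 + 8 * x1 ^+ 2 * w1)
  + pot1 x1 x2 * w1 + pot1 x2 x1 * w2.
Definition hkhat y1 y2 x1 x2 e1 e2 w1 w2 e1' e2' w1' w2' : R :=
  (e1 - 8 * x2 ^+ 2 * w2) * (e1' - 8 * x2 ^+ 2 * w2')
  + (e2 + 8 * x1 ^+ 2 * w1) * (e2' + 8 * x1 ^+ 2 * w1')
  - 16 * ((y1 - 8 / 3 * x2 ^+ 3) * x2 * w2 * w2'
          - (y2 + 8 / 3 * x1 ^+ 3) * x1 * w1 * w1')
  + pot11 x1 x2 * w1 * w1' + pot12 x1 x2 * (w1 * w2' + w2 * w1')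
  + pot11 x2 x1 * w2 * w2'.

Variable V : normedModType R.
Implicit Types (z v : V).

Lemma is_derive_khat (y1 y2 x1 x2 : V -> R) e1 e2 w1 w2 z v :
  is_derive z v y1 e1 -> is_derive z v y2 e2 ->
  is_derive z v x1 w1 -> is_derive z v x2 w2 ->
  is_derive z v (fun t => khat (y1 t) (y2 t) (x1 t) (x2 t))
    (dkhat (y1 z) (y2 z) (x1 z) (x2 z) e1 e2 w1 w2).
Proof.
move=> dy1 dy2 dx1 dx2.
rewrite /khat /pot; apply: is_derive_eq; rewrite /dkhat /pot1 /GRing.scale /=; move: dy1 dy2 dx1 dx2.
by move: (y1 z) (y2 z) (x1 z) (x2 z) => a b c d _ _ _ _; field.
Qed.

Lemma is_derive_dkhat (y1 y2 x1 x2 e1 e2 w1 w2 : V -> R)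
    e1' e2' w1' w2' e1'' e2'' w1'' w2'' z v :
  is_derive z v y1 e1' -> is_derive z v y2 e2' ->
  is_derive z v x1 w1' -> is_derive z v x2 w2' ->
  is_derive z v e1 e1'' -> is_derive z v e2 e2'' ->
  is_derive z v w1 w1'' -> is_derive z v w2 w2'' ->
  is_derive z v
    (fun t => dkhat (y1 t) (y2 t) (x1 t) (x2 t) (e1 t) (e2 t) (w1 t) (w2 t))
    (hkhat (y1 z) (y2 z) (x1 z) (x2 z) (e1 z) (e2 z) (w1 z) (w2 z) e1' e2' w1' w2'
     + dkhat (y1 z) (y2 z) (x1 z) (x2 z) e1'' e2'' w1'' w2'').
Proof.
move=> dy1 dy2 dx1 dx2 de1 de2 dw1 dw2.
rewrite /dkhat /pot1; apply: is_derive_eq; rewrite /hkhat /dkhat /pot1 /pot11 /pot12 /GRing.scale /=.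
clear; move: (y1 z) (y2 z) (x1 z) (x2 z) (e1 z) (e2 z) (w1 z) (w2 z).
by move=> a b c d a' b' c' d'; field.
Qed.

End Scalars.

Section SecondOrder.
Variable R : realType.

(** If the second derivative were positive, the first one would be positive just
    to the right of the maximum. *)
Lemma local_max_second_order (f df : R -> R) (d2 : R) :
  (forall t : R, is_derive t 1 f (df t)) -> is_derive (0 : R) 1 df d2 ->
  (\forall t \near (0 : R), f t <= f 0) -> df 0 = 0 /\ d2 <= 0.
Proof.
move=> fd d2d /nbhs_ballP[e /= e0 emax].
have emax' t : `|t| < e -> f t <= f 0.
  by move=> te; apply: emax; rewrite -ball_normE /= sub0r normrN.
have df0 : df 0 = 0.
  have fd0 : is_derive (0 : R) 1 f 0.
    apply: (@derive1_at_max R f (- e) e 0); first by rewrite ltW // gtrN.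
    - by move=> t _; apply: (@ex_derive _ _ _ _ _ _ _ (fd t)).
    - by rewrite in_itv /= oppr_lt0 e0.
    - move=> t; rewrite in_itv /= => /andP[te et].
      by apply: emax'; rewrite ltr_norml te.
  rewrite -(@derive_val _ _ _ _ _ _ _ (fd 0)).
  exact: (@derive_val _ _ _ _ _ _ _ fd0).
split=> //; rewrite leNgt; apply/negP => d20.
have /cvgrPdist_lt/(_ _ d20) : h^-1 *: (df (h *: 1 + 0) - df 0) @[h --> 0^'] --> d2.
  have [dd dE] := d2d; move: dd; rewrite /derivable => /cvg_ex[l cl].
  by rewrite -dE /derive; have -> := cvg_lim _ cl.
move=> /nbhs_ballP[r /= r0 rP].
pose h := Num.min e r / 2.
have m0 : 0 < Num.min e r by rewrite lt_min e0 r0.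
have h0 : 0 < h by rewrite divr_gt0.
have : h < Num.min e r by move: m0; rewrite /h; set m := Num.min _ _; lra.
rewrite lt_min => /andP[he hr].
have df_gt0 t : 0 < t < r -> 0 < df t.
  move=> /andP[t0 tr].
  have /rP : ball (0 : R) r t by rewrite -ball_normE /= sub0r normrN gtr0_norm.
  move=> /(_ (lt0r_neq0 t0)); rewrite df0 subr0 addr0 [t%:A]mulr1.
  rewrite ltr_distlC subrr => /andP[+ _].
  by rewrite pmulr_rgt0 // invr_gt0.
have [|c /[!in_itv]/= /andP[c0 ch] fE] := @MVT R f df 0 h h0 (fun t _ => fd t).
  apply: derivable_within_continuous => t _.
  exact: (@ex_derive _ _ _ _ _ _ _ (fd t)).
have : 0 < f h - f 0.
  by rewrite fE mulr_gt0 ?subr0 // df_gt0 // c0 (lt_trans ch).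
by rewrite ltNge subr_le0 emax' // gtr0_norm.
Qed.
End SecondOrder.

Section Scaling.
Variable R : realType.
Implicit Types s t x y w u b : R.

(** With s^2 = sqrt 2 / 3 the saddles have rescaled coordinate 1, and
    t^2 = 8 s^2 / 3 is the critical value. *)
Lemma pot_scale s t x1 x2 : s ^+ 4 = 2 / 9 -> t ^+ 2 = 8 / 3 * s ^+ 2 ->
  pot (s * x1) (s * x2) = t ^+ 2 * (1 - slack (x1 ^+ 2) (x2 ^+ 2) / 2).
Proof.
move=> s4 ->; rewrite /pot /slack.
transitivity (4 * s ^+ 2 * (x1 ^+ 2 + x2 ^+ 2)
  - 6 * s ^+ 2 * s ^+ 4 * (x1 ^+ 2 + x2 ^+ 2) * (x1 ^+ 2 - x2 ^+ 2) ^+ 2); first by ring.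
by rewrite s4; field.
Qed.

Lemma pot1_scale s t x1 x2 : s ^+ 4 = 2 / 9 -> t ^+ 2 = 8 / 3 * s ^+ 2 ->
  s * pot1 (s * x1) (s * x2) = t ^+ 2 * (x1 * grad1 (x1 ^+ 2) (x2 ^+ 2)).
Proof.
move=> s4 ->; rewrite /pot1 /grad1.
transitivity (8 * s ^+ 2 * x1 - s ^+ 2 * s ^+ 4 * 4 * x1 *
  (3 * (x1 ^+ 2 - x2 ^+ 2) ^+ 2
   + 6 * (x1 ^+ 2 + x2 ^+ 2) * (x1 ^+ 2 - x2 ^+ 2))); first by ring.
by rewrite s4; field.
Qed.

Lemma pot11_scale s t x1 x2 : s ^+ 4 = 2 / 9 -> t ^+ 2 = 8 / 3 * s ^+ 2 ->
  s ^+ 2 * pot11 (s * x1) (s * x2) = t ^+ 2 * hess11 (x1 ^+ 2) (x2 ^+ 2).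
Proof.
move=> s4 ->; rewrite /pot11 /hess11.
transitivity (8 * s ^+ 2 - s ^+ 2 * s ^+ 4 * (4 *
  (3 * (x1 ^+ 2 - x2 ^+ 2) ^+ 2
   + 6 * (x1 ^+ 2 + x2 ^+ 2) * (x1 ^+ 2 - x2 ^+ 2))
   + 48 * x1 ^+ 2 * (3 * x1 ^+ 2 - x2 ^+ 2))); first by ring.
by rewrite s4; field.
Qed.

Lemma pot12_scale s t x1 x2 : s ^+ 4 = 2 / 9 -> t ^+ 2 = 8 / 3 * s ^+ 2 ->
  s ^+ 2 * pot12 (s * x1) (s * x2) = t ^+ 2 * (4 * x1 * x2 * (x1 ^+ 2 + x2 ^+ 2)).
Proof.
move=> s4 ->; rewrite /pot12.
transitivity (s ^+ 2 * s ^+ 4 * (48 * x1 * x2 * (x1 ^+ 2 + x2 ^+ 2))); first by ring.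
by rewrite s4; field.
Qed.

(** The main estimate, obtained from its rescaled form by x = s X, w = s W and
    u = t U; the magnetic constant 16 becomes 16 s^3 / t, whose square is
    64 / 3. *)
Lemma hkhat_gt0 c y1 y2 x1 x2 e1 e2 w1 w2 : 0 < c -> c ^+ 2 = 2 / 9 ->
  `|x1 ^+ 2 - x2 ^+ 2| < c -> khat y1 y2 x1 x2 <= 8 / 3 * c ->
  dkhat y1 y2 x1 x2 e1 e2 w1 w2 = 0 ->
  [|| e1 != 0, e2 != 0, w1 != 0 | w2 != 0] ->
  0 < hkhat y1 y2 x1 x2 e1 e2 w1 w2 e1 e2 w1 w2.
Proof.
move=> c0 c2 xc kc dk0 nz.
pose s := Num.sqrt c; pose t := Num.sqrt (8 / 3 * c).
have s0 : 0 < s by rewrite sqrtr_gt0.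
have t0 : 0 < t by rewrite sqrtr_gt0 mulr_gt0.
have s2 : s ^+ 2 = c by rewrite sqr_sqrtr // ltW.
have t2 : t ^+ 2 = 8 / 3 * s ^+ 2 by rewrite s2 sqr_sqrtr // mulr_ge0 // ltW.
have s4 : s ^+ 4 = 2 / 9 by rewrite -c2 -s2; ring.
have [sn0 tn0] : s != 0 /\ t != 0 by rewrite !gt_eqF.
rewrite -s2 in xc kc.
have [ex1 ex2] : s * (x1 / s) = x1 /\ s * (x2 / s) = x2 by split; field.
have [ew1 ew2] : s * (w1 / s) = w1 /\ s * (w2 / s) = w2 by split; field.
move: {c c0 c2 s2} s t s0 t0 t2 s4 sn0 tn0 xc kc ex1 ex2 ew1 ew2 => s t.
move: (x1 / s) (x2 / s) (w1 / s) (w2 / s) => X1 X2 W1 W2 s0 t0 t2 s4 sn0 tn0 xc kc.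
move=> ex1 ex2 ew1 ew2; move: xc kc dk0 nz; rewrite -{}ex1 -{}ex2 -{}ew1 -{}ew2.
move=> {x1 x2 w1 w2} xc kc dk0 nz.
rewrite /khat /dkhat /hkhat in kc dk0 *.
move: kc dk0; set u1 := y1 - _; set u2 := y2 + _ => kc dk0.
set b1 := e1 - _; set b2 := e2 + _; rewrite -/b1 -/b2 in dk0.
have nzb : [|| b1 / t != 0, b2 / t != 0, W1 != 0 | W2 != 0].
  have [W10|] := eqVneq W1 0; last by rewrite !orbT.
  have [W20|] := eqVneq W2 0; last by rewrite !orbT.
  move: nz; rewrite /b1 /b2 W10 W20 !mulr0 subr0 addr0 eqxx !orbF.
  by rewrite !mulf_eq0 !invr_eq0 (negbTE tn0) !orbF.
have tt0 : 0 < t ^+ 2 by rewrite exprn_gt0.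
have eu (a : R) : t * (a / t) = a by field.
have sl : (u1 / t) ^+ 2 + (u2 / t) ^+ 2 <= slack (X1 ^+ 2) (X2 ^+ 2).
  rewrite (pot_scale _ _ s4 t2) -t2 in kc.
  rewrite -(ler_pM2l tt0).
  have -> : t ^+ 2 * ((u1 / t) ^+ 2 + (u2 / t) ^+ 2) = u1 ^+ 2 + u2 ^+ 2 by field.
  lra.
have d0 : u1 / t * (b1 / t) + u2 / t * (b2 / t)
  + X1 * grad1 (X1 ^+ 2) (X2 ^+ 2) * W1 + X2 * grad1 (X2 ^+ 2) (X1 ^+ 2) * W2 = 0.
  apply: (mulfI (lt0r_neq0 tt0)); rewrite mulr0 -dk0.
  transitivity (u1 * b1 + u2 * b2 + t ^+ 2 * (X1 * grad1 (X1 ^+ 2) (X2 ^+ 2)) * W1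
    + t ^+ 2 * (X2 * grad1 (X2 ^+ 2) (X1 ^+ 2)) * W2); first by field.
  by rewrite -!(pot1_scale _ _ s4 t2); ring.
have xc1 : `|X1 ^+ 2 - X2 ^+ 2| < 1.
  have ss0 : 0 < s ^+ 2 by rewrite exprn_gt0.
  rewrite -(ltr_pM2l ss0) mulr1; move: xc.
  by rewrite !exprMn -mulrBr normrM gtr0_norm.
have k2 : (16 * s ^+ 3 / t) ^+ 2 = 64 / 3.
  transitivity (256 * s ^+ 2 * s ^+ 4 / t ^+ 2); first by field.
  by rewrite t2 s4; field.
have := tangential_hessian_gt0 k2 xc1 sl d0 nzb; rewrite -(pmulr_rgt0 _ tt0).
congr (0 < _).
transitivity (b1 ^+ 2 + b2 ^+ 2
  - 16 * (u1 * (s * X2) * (s * W2) * (s * W2) - u2 * (s * X1) * (s * W1) * (s * W1))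
  + (t ^+ 2 * hess11 (X1 ^+ 2) (X2 ^+ 2)) * W1 ^+ 2
  + 2 * (t ^+ 2 * (4 * X1 * X2 * (X1 ^+ 2 + X2 ^+ 2))) * W1 * W2
  + (t ^+ 2 * hess11 (X2 ^+ 2) (X1 ^+ 2)) * W2 ^+ 2); first by field.
rewrite -!(pot11_scale _ _ s4 t2) -(pot12_scale _ _ s4 t2); ring.
Qed.
End Scaling.

Section Potential.
Variable R : realType.
Implicit Types x w s h : R.

(** The square of the distance from the origin to the saddles; the critical value
    of the potential is 8 / 3 of it. *)
Definition saddle_sq : R := Num.sqrt 2 / 3.

Lemma saddle_sq_gt0 : 0 < saddle_sq.
Proof. by rewrite divr_gt0 // sqrtr_gt0. Qed.

Lemma sqr_saddle_sq : saddle_sq ^+ 2 = 2 / 9.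
Proof. by rewrite /saddle_sq exprMn sqr_sqrtr //; field. Qed.

Definition dif x1 x2 : R := x1 ^+ 2 - x2 ^+ 2.

Lemma dif_sqr_le x1 x2 : `|dif x1 x2| <= saddle_sq -> dif x1 x2 ^+ 2 <= 2 / 9.
Proof.
move=> dc; rewrite -sqr_saddle_sq -[leLHS]real_normK ?num_real // ler_sqr ?nnegrE //.
exact: ltW saddle_sq_gt0.
Qed.

(** The bound 3 (x1^2 - x2^2)^2 <= 2 / 3 on the strip. *)
Lemma pot_ge x1 x2 : `|dif x1 x2| <= saddle_sq -> 8 / 3 * (x1 ^+ 2 + x2 ^+ 2) <= pot x1 x2.
Proof.
move=> /dif_sqr_le dc; rewrite /pot -/(dif x1 x2) -subr_ge0.
rewrite [X in 0 <= X](_ : _ = 6 * (x1 ^+ 2 + x2 ^+ 2) * (2 / 9 - dif x1 x2 ^+ 2));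
  last by field.
by rewrite mulr_ge0 ?subr_ge0 // mulr_ge0 // addr_ge0 ?sqr_ge0.
Qed.

Lemma dif_le_sum x1 x2 : `|dif x1 x2| <= x1 ^+ 2 + x2 ^+ 2.
Proof.
rewrite ler_norml /dif; have := sqr_ge0 x1; have := sqr_ge0 x2.
by move=> *; apply/andP; split; lra.
Qed.

Lemma pot_edge x1 x2 : `|dif x1 x2| = saddle_sq -> 8 / 3 * saddle_sq <= pot x1 x2.
Proof.
move=> dc; apply: le_trans (pot_ge _); last by rewrite dc.
by rewrite ler_wpM2l // -dc dif_le_sum.
Qed.

Lemma pot_corner x1 x2 : `|dif x1 x2| = saddle_sq -> pot x1 x2 <= 8 / 3 * saddle_sq ->
  (x1 ^+ 2 = saddle_sq /\ x2 = 0) \/ (x1 = 0 /\ x2 ^+ 2 = saddle_sq).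
Proof.
move=> dc pc; have := le_trans (pot_ge _) pc; rewrite dc => /(_ (lexx _)).
rewrite ler_pM2l // => sc; have c0 := @saddle_sq_gt0.
move/eqP: dc; rewrite eqr_norml (ltW c0) andbT /dif => /orP[] /eqP dE.
  left; have x20 : x2 ^+ 2 = 0 by have := sqr_ge0 x2; lra.
  by split; [lra|apply/eqP; rewrite -sqrf_eq0 x20].
right; have x10 : x1 ^+ 2 = 0 by have := sqr_ge0 x1; lra.
by split; [apply/eqP; rewrite -sqrf_eq0 x10|lra].
Qed.

(** The difference factors, and in the strip 3 d^2 (1 + s^2 + s^4) < 2 because
    d^2 <= 2 / 9 and s < 1. *)
Lemma pot_radial x1 x2 s : 0 <= s < 1 -> `|dif x1 x2| <= saddle_sq ->
  0 < x1 ^+ 2 + x2 ^+ 2 -> pot (s * x1) (s * x2) < pot x1 x2.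
Proof.
move=> /andP[s0 s1] /dif_sqr_le dc x0; rewrite -subr_gt0.
rewrite [X in 0 < X](_ : _ = 2 * (x1 ^+ 2 + x2 ^+ 2) * ((1 - s ^+ 2) *
  (2 - 3 * (dif x1 x2 ^+ 2) * (1 + s ^+ 2 + s ^+ 4)))); last first.
  by rewrite /pot /dif; ring.
have s2 : s ^+ 2 < 1 by rewrite expr_lt1.
have s4 : s ^+ 4 < 1 by rewrite expr_lt1.
rewrite mulr_gt0 ?mulr_gt0 ?subr_gt0 //.
apply: (@le_lt_trans _ _ (3 * (2 / 9) * (1 + s ^+ 2 + s ^+ 4))).
  rewrite ler_wpM2r ?addr_ge0 ?exprn_ge0 //.
  by rewrite ler_wpM2l.
by lra.
Qed.

Lemma pot_radial_le x1 x2 s : 0 <= s <= 1 -> `|dif x1 x2| <= saddle_sq ->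
  pot (s * x1) (s * x2) <= pot x1 x2.
Proof.
move=> /andP[s0]; rewrite le_eqVlt => /predU1P[->|s1] dc; first by rewrite !mul1r.
have [x0|x0] := ltP 0 (x1 ^+ 2 + x2 ^+ 2); first by rewrite ltW // pot_radial // s0.
have x10 : x1 = 0.
  by apply/eqP; rewrite -sqrf_eq0 eq_le sqr_ge0 andbT; have := sqr_ge0 x2; lra.
have x20 : x2 = 0.
  by apply/eqP; rewrite -sqrf_eq0 eq_le sqr_ge0 andbT; have := sqr_ge0 x1; lra.
by rewrite x10 x20 !mulr0.
Qed.

Lemma dif_scale x1 x2 s : dif (s * x1) (s * x2) = s ^+ 2 * dif x1 x2.
Proof. by rewrite /dif; ring. Qed.

(** At a critical point u = 0, and the radial derivative of the potential,
    4 |x|^2 (2 - 9 d^2), forces x = 0. *)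
Lemma dkhat_eq0 y1 y2 x1 x2 : `|dif x1 x2| < saddle_sq ->
  (forall e1 e2 w1 w2, dkhat y1 y2 x1 x2 e1 e2 w1 w2 = 0) ->
  khat y1 y2 x1 x2 = 0.
Proof.
move=> dc dk0; have c0 := saddle_sq_gt0.
have u1 : y1 - 8 / 3 * x2 ^+ 3 = 0 by rewrite -(dk0 1 0 0 0) /dkhat; ring.
have u2 : y2 + 8 / 3 * x1 ^+ 3 = 0 by rewrite -(dk0 0 1 0 0) /dkhat; ring.
have p0 : 4 * (x1 ^+ 2 + x2 ^+ 2) * (2 - 9 * dif x1 x2 ^+ 2) = 0.
  rewrite -(dk0 0 0 x1 x2) /dkhat u1 u2 !mul0r !add0r /pot1 /dif; ring.
have d2 : dif x1 x2 ^+ 2 < 2 / 9.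
  by rewrite -sqr_saddle_sq -[ltLHS]real_normK ?num_real // ltr_sqr ?nnegrE // ltW.
have x0 : x1 ^+ 2 + x2 ^+ 2 = 0.
  by move/eqP: p0; rewrite !mulf_eq0 => /orP[/orP[|/eqP//]|/eqP]; lra.
by rewrite /khat u1 u2 /pot x0; ring.
Qed.

(** Over a saddle the Hessian has exactly one negative direction, the one
    transversal to the edge of the strip; the condition on w excludes it. *)
Lemma hkhat_corner_gt0 y1 y2 x1 x2 e1 e2 w1 w2 :
  y1 - 8 / 3 * x2 ^+ 3 = 0 -> y2 + 8 / 3 * x1 ^+ 3 = 0 ->
  (x1 ^+ 2 = saddle_sq /\ x2 = 0) \/ (x1 = 0 /\ x2 ^+ 2 = saddle_sq) ->
  x1 * w1 - x2 * w2 = 0 -> [|| e1 != 0, e2 != 0, w1 != 0 | w2 != 0] ->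
  0 < hkhat y1 y2 x1 x2 e1 e2 w1 w2 e1 e2 w1 w2.
Proof.
move=> u1 u2 corner xw nz; rewrite /hkhat u1 u2; have c0 := saddle_sq_gt0.
have sq (a : R) : a != 0 -> 0 < a ^+ 2 by move=> a0; rewrite exprn_even_gt0.
have [[x1c x20]|[x10 x2c]] := corner.
  have x1n : x1 != 0 by rewrite -sqrf_eq0 x1c gt_eqF.
  have w10 : w1 = 0.
    by apply: (mulfI x1n); rewrite mulr0 -xw x20; ring.
  rewrite [X in 0 < X](_ : _ = e1 ^+ 2 + e2 ^+ 2 + 32 / 3 * w2 ^+ 2); last first.
    rewrite /pot11 w10 x20 !x1c.
    transitivity (e1 ^+ 2 + e2 ^+ 2 + (8 + 12 * saddle_sq ^+ 2) * w2 ^+ 2); first by ring.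
    by rewrite sqr_saddle_sq; field.
  move: nz; rewrite w10 eqxx /= => /or3P[] /sq; have := sqr_ge0 e1; have := sqr_ge0 e2; have := sqr_ge0 w2; lra.
have x2n : x2 != 0 by rewrite -sqrf_eq0 x2c gt_eqF.
have w20 : w2 = 0.
  by apply: (mulfI x2n); rewrite mulr0 -[RHS]oppr0 -xw x10; ring.
rewrite [X in 0 < X](_ : _ = e1 ^+ 2 + e2 ^+ 2 + 32 / 3 * w1 ^+ 2); last first.
  rewrite /pot11 w20 x10 !x2c.
  transitivity (e1 ^+ 2 + e2 ^+ 2 + (8 + 12 * saddle_sq ^+ 2) * w1 ^+ 2); first by ring.
  by rewrite sqr_saddle_sq; field.
move: nz; rewrite w20 eqxx orbF /= => /or3P[] /sq; have := sqr_ge0 e1; have := sqr_ge0 e2; have := sqr_ge0 w1; lra.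
Qed.

End Potential.
Arguments saddle_sq {R}.

(** * The convex body *)

Section PhaseSpace.
Variable R : realType.
Local Notation T := 'rV[R]_(2 + 2).
Implicit Types (z w : T) (h s t : R).

(** The positions of y1, y2, x1, x2 in a vector encoded as [row_mx y x]. *)
Definition iy1 : 'I_(2 + 2) := lshift 2 ord0.
Definition iy2 : 'I_(2 + 2) := lshift 2 ord_max.
Definition ix1 : 'I_(2 + 2) := rshift 2 ord0.
Definition ix2 : 'I_(2 + 2) := rshift 2 ord_max.

Definition vec4 (a b c d : R) : T :=
  a *: delta_mx ord0 iy1 + b *: delta_mx ord0 iy2
  + c *: delta_mx ord0 ix1 + d *: delta_mx ord0 ix2.

Lemma vec4E a b c d :
  (vec4 a b c d ord0 iy1 = a) * (vec4 a b c d ord0 iy2 = b) *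
  (vec4 a b c d ord0 ix1 = c) * (vec4 a b c d ord0 ix2 = d).
Proof. by do !split; rewrite !mxE /= !(mulr1, mulr0, addr0, add0r). Qed.

Lemma ord4P (P : 'I_(2 + 2) -> Prop) :
  P iy1 -> P iy2 -> P ix1 -> P ix2 -> forall i, P i.
Proof.
move=> P1 P2 P3 P4 i; case: (split_ordP i) => j ->.
  case: j => [[|[|//]] jlt].
    by rewrite (_ : lshift _ _ = iy1) //; apply/val_inj.
  by rewrite (_ : lshift _ _ = iy2) //; apply/val_inj.
case: j => [[|[|//]] jlt].
  by rewrite (_ : rshift _ _ = ix1) //; apply/val_inj.
by rewrite (_ : rshift _ _ = ix2) //; apply/val_inj.
Qed.

Lemma vec4_ext z w : z ord0 iy1 = w ord0 iy1 -> z ord0 iy2 = w ord0 iy2 ->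
  z ord0 ix1 = w ord0 ix1 -> z ord0 ix2 = w ord0 ix2 -> z = w.
Proof. by move=> *; apply/rowP; apply: ord4P. Qed.

Definition Kh z := khat (z ord0 iy1) (z ord0 iy2) (z ord0 ix1) (z ord0 ix2).
Definition dK z w := dkhat (z ord0 iy1) (z ord0 iy2) (z ord0 ix1) (z ord0 ix2)
  (w ord0 iy1) (w ord0 iy2) (w ord0 ix1) (w ord0 ix2).
Definition hK z w w' := hkhat (z ord0 iy1) (z ord0 iy2) (z ord0 ix1) (z ord0 ix2)
  (w ord0 iy1) (w ord0 iy2) (w ord0 ix1) (w ord0 ix2)
  (w' ord0 iy1) (w' ord0 iy2) (w' ord0 ix1) (w' ord0 ix2).
Definition Dif z := dif (z ord0 ix1) (z ord0 ix2).

(** The components of u = y - a(x). *)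
Definition mom1 z := z ord0 iy1 - 8 / 3 * z ord0 ix2 ^+ 3.
Definition mom2 z := z ord0 iy2 + 8 / 3 * z ord0 ix1 ^+ 3.
Definition Pot z := pot (z ord0 ix1) (z ord0 ix2).

Lemma KhE z : Kh z = 2^-1 * mom1 z ^+ 2 + 2^-1 * mom2 z ^+ 2 + Pot z.
Proof. by []. Qed.

Lemma Pot_le z : Pot z <= Kh z.
Proof. by rewrite KhE lerDr addr_ge0 // mulr_ge0 ?sqr_ge0. Qed.

(** The points over the four saddles at which u = 0; they are the singular points of
    the critical energy surface. *)
Definition corner z := [/\ mom1 z = 0, mom2 z = 0 &
  (z ord0 ix1 ^+ 2 = saddle_sq /\ z ord0 ix2 = 0) \/ (z ord0 ix1 = 0 /\ z ord0 ix2 ^+ 2 = saddle_sq)].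

Lemma neq0_vec4 w : w != 0 ->
  [|| w ord0 iy1 != 0, w ord0 iy2 != 0, w ord0 ix1 != 0 | w ord0 ix2 != 0].
Proof.
move=> w0; apply: contraT; rewrite !negb_or !negbK => /and4P[/eqP e1 /eqP e2 /eqP w1 /eqP w2].
by move: w0; rewrite (_ : w = 0) ?eqxx //; apply: vec4_ext; rewrite mxE.
Qed.

Variable h : R.
Hypotheses (h0 : 0 < h) (hc : h <= 8 / 3 * saddle_sq).

Definition body : set T := [set z | Kh z <= h /\ `|Dif z| <= saddle_sq].
Definition shell : set T := [set z | Kh z = h /\ `|Dif z| <= saddle_sq].

(** The interior of [body]. *)
Definition inner_body : set T := [set z | Kh z < h /\ `|Dif z| < saddle_sq].

(** On the edge of the strip the potential alone is already at least the critical
    value, which leaves no room for the kinetic term. *)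
Lemma edge_corner z : body z -> `|Dif z| = saddle_sq -> Kh z = h /\ corner z.
Proof.
move=> [Kz _] dz; have pz := pot_edge dz; rewrite -/(Pot z) in pz.
have s1 := sqr_ge0 (mom1 z); have s2 := sqr_ge0 (mom2 z).
have Kh_eq : Kh z = h.
  by apply/eqP; rewrite eq_le Kz (le_trans hc) // (le_trans pz) // Pot_le.
have PE : Pot z = Kh z.
  by apply/eqP; rewrite eq_le Pot_le (le_trans _ pz) // Kh_eq.
have KE := KhE z; rewrite PE in KE.
have m10 : mom1 z ^+ 2 = 0 by move: (mom1 z ^+ 2) (mom2 z ^+ 2) (Kh z) KE s1 s2 => *; lra.
have m20 : mom2 z ^+ 2 = 0 by move: (mom1 z ^+ 2) (mom2 z ^+ 2) (Kh z) KE s1 s2 => *; lra.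
split=> //; split; try by apply/eqP; rewrite -sqrf_eq0; apply/eqP.
by apply: pot_corner dz _; rewrite -/(Pot z) PE Kh_eq.
Qed.

Lemma lt_inner z : Kh z < h -> `|Dif z| <= saddle_sq -> inner_body z.
Proof.
move=> Kz; rewrite le_eqVlt => /predU1P[dz|]; last by [].
have [] := edge_corner _ dz; first by split; [exact: ltW|rewrite dz].
by move=> KE; move: Kz; rewrite KE ltxx.
Qed.

Lemma hK_gt0 z w : shell z -> `|Dif z| < saddle_sq -> dK z w = 0 -> w != 0 -> 0 < hK z w w.
Proof.
move=> [Kz _] dz dKw w0; apply: (hkhat_gt0 (@saddle_sq_gt0 R) (@sqr_saddle_sq R)) dKw _ => //.
  by rewrite -/(Kh z) Kz.
exact: neq0_vec4.
Qed.

Lemma hK_corner_gt0 z w : corner z ->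
  z ord0 ix1 * w ord0 ix1 - z ord0 ix2 * w ord0 ix2 = 0 -> w != 0 -> 0 < hK z w w.
Proof.
by move=> [u1 u2 cz] xw /neq0_vec4; apply: hkhat_corner_gt0.
Qed.

Lemma is_derive_coord_line z w i t :
  is_derive t 1 (fun r : R => (z + r *: w) ord0 i) (w ord0 i).
Proof.
have -> : (fun r : R => (z + r *: w) ord0 i) = (fun r => z ord0 i + r * w ord0 i).
  by apply/funext => r; rewrite !mxE.
apply: is_derive_eq; rewrite /GRing.scale /=; ring.
Qed.

(** Along the segment K has a local maximum at z, so its first derivative vanishes
    and its second one is nonpositive, against the main estimate.  Over a saddle
    the function x1^2 - x2^2 also has an extremum along the segment, which excludes
    the negative direction of the Hessian. *)
Lemma no_tangent_segment z w : shell z -> w != 0 ->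
  (\forall t \near (0 : R), body (z + t *: w)) -> False.
Proof.
move=> Mz w0 bd; have z0 i : (z + (0 : R) *: w) ord0 i = z ord0 i.
  by rewrite scale0r addr0.
pose f t := Kh (z + t *: w); pose df t := dK (z + t *: w) w.
have fd t : is_derive t 1 f (df t).
  by apply: is_derive_khat; exact: is_derive_coord_line.
have dfd : is_derive (0 : R) 1 df (hK z w w).
  have := is_derive_dkhat (is_derive_coord_line z w iy1 0)
    (is_derive_coord_line z w iy2 0) (is_derive_coord_line z w ix1 0)
    (is_derive_coord_line z w ix2 0)
    (is_derive_cst (w ord0 iy1) (0 : R) (1 : R)) (is_derive_cst (w ord0 iy2) (0 : R) (1 : R))
    (is_derive_cst (w ord0 ix1) (0 : R) (1 : R)) (is_derive_cst (w ord0 ix2) (0 : R) (1 : R)).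
  move=> H; apply: (is_derive_eq H); rewrite !z0 /cst /hK.
  by rewrite [X in _ + X](_ : _ = 0) ?addr0 // /dkhat; ring.
have f0 : f 0 = h by rewrite /f scale0r addr0; exact: Mz.1.
have [|df0 hK0] := local_max_second_order fd dfd.
  by apply: filterS bd => t [Kt _]; rewrite f0.
have dKw : dK z w = 0 by rewrite -df0 /df scale0r addr0.
have [dz|dz] := ltP `|Dif z| saddle_sq.
  by have := hK_gt0 Mz dz dKw w0; rewrite ltNge hK0.
have dE : `|Dif z| = saddle_sq by apply/eqP; rewrite eq_le dz Mz.2.
have [_ cz] : Kh z = h /\ corner z.
  by apply: edge_corner dE; split; [rewrite Mz.1|exact: Mz.2].
suff xw : z ord0 ix1 * w ord0 ix1 - z ord0 ix2 * w ord0 ix2 = 0.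
  by have := hK_corner_gt0 cz xw w0; rewrite ltNge hK0.
(* the sign makes |x1^2 - x2^2| smooth near z *)
pose sg := Num.sg (Dif z).
pose g t := sg * dif ((z + t *: w) ord0 ix1) ((z + t *: w) ord0 ix2).
pose dg t := sg * (2 * ((z + t *: w) ord0 ix1 * w ord0 ix1
                    - (z + t *: w) ord0 ix2 * w ord0 ix2)).
have sg1 : `|sg| = 1.
  by rewrite normr_sg -normr_eq0 dE gt_eqF // saddle_sq_gt0.
have gd t : is_derive t 1 g (dg t).
  rewrite /g /dif.
  have d1 := is_derive_coord_line z w ix1 t.
  have d2 := is_derive_coord_line z w ix2 t.
  by apply: is_derive_eq; rewrite /dg /GRing.scale /=; ring.
have g0 : g 0 = saddle_sq by rewrite /g !z0 -dE normrEsg.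
have dgd : is_derive (0 : R) 1 dg (sg * (2 * (w ord0 ix1 ^+ 2 - w ord0 ix2 ^+ 2))).
  rewrite /dg.
  have d1 := is_derive_coord_line z w ix1 0.
  have d2 := is_derive_coord_line z w ix2 0.
  by apply: is_derive_eq; rewrite /GRing.scale /=; ring.
have [|dg0 _] := local_max_second_order gd dgd.
  apply: filterS bd => t [_ dt]; rewrite g0; apply: le_trans dt.
  by apply: le_trans (ler_norm _) _; rewrite normrM sg1 mul1r.
move: dg0; rewrite /dg !z0 => /eqP; rewrite !mulf_eq0 -normr_eq0 sg1 oner_eq0.
by rewrite pnatr_eq0 /= => /eqP.
Qed.

End PhaseSpace.

Section Regularity.
Variables (R : realType).
Local Notation T := 'rV[R]_(2 + 2).

Lemma Ck_coord n k (i : 'I_n) : Ck_on k [set: 'rV[R]_n] (fun z => z ord0 i).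
Proof.
case: k => [|k] /=; first by move=> x _; exact: coord_continuous.
split=> [x _|v]; first exact: differentiable_coord.
have -> : 'D_v (fun z : 'rV[R]_n => z ord0 i) = cst (v ord0 i).
  by apply/funext => x; rewrite (@derive_val _ _ _ _ _ _ _ (is_derive_proj x v i)).
exact: Ck_cst.
Qed.

Lemma Ck_continuous (V W : normedModType R) (f : V -> W) :
  Ck_on 0 [set: V] f -> continuous f.
Proof. by move=> cf x; exact: cf. Qed.

Lemma Ck_Dif k : Ck_on k [set: T] (@Dif R).
Proof.
pose x1 (z : T) : R := z ord0 ix1; pose x2 (z : T) : R := z ord0 ix2.
have -> : @Dif R = x1 ^+ 2 - x2 ^+ 2 by apply/funext.
by apply: CkD; [|apply: CkN]; apply: CkX; exact: Ck_coord.
Qed.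

Lemma Ck_Kh k : Ck_on k [set: T] (@Kh R).
Proof.
pose y1 (z : T) : R := z ord0 iy1; pose y2 (z : T) : R := z ord0 iy2.
pose x1 (z : T) : R := z ord0 ix1; pose x2 (z : T) : R := z ord0 ix2.
have -> : @Kh R = cst 2^-1 * (y1 - cst (8 / 3) * x2 ^+ 3) ^+ 2
  + cst 2^-1 * (y2 + cst (8 / 3) * x1 ^+ 3) ^+ 2
  + cst 2 * (x1 ^+ 2 + x2 ^+ 2) * (cst 2 - cst 3 * (x1 ^+ 2 - x2 ^+ 2) ^+ 2).
  by apply/funext.
have [cy1 cy2 cx1 cx2] : [/\ Ck_on k setT y1, Ck_on k setT y2, Ck_on k setT x1 &
  Ck_on k setT x2] by split; exact: Ck_coord.
by repeat first [exact: Ck_cst | assumption | apply: CkX | apply: CkN | apply: CkM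
  | apply: CkD].
Qed.

Lemma Ck_vec4 (V : normedModType R) k (a b c d : V -> R) :
  Ck_on k setT a -> Ck_on k setT b -> Ck_on k setT c -> Ck_on k setT d ->
  Ck_on k setT (fun x => vec4 (a x) (b x) (c x) (d x)).
Proof. by move=> *; do 3?[apply: CkD]; apply: CkZl. Qed.

Lemma open_inner h : open (@inner_body R h).
Proof.
apply: openI.
  apply: (@open_comp _ _ (@Kh R) [set x | x < h]); last exact: open_lt.
  by move=> z _; exact: (Ck_continuous (Ck_Kh 0)).
apply: (@open_comp _ _ (fun z => `|Dif z| : R) [set x | x < saddle_sq]); last exact: open_lt.
by move=> z _; apply: continuous_comp; [exact: (Ck_continuous (Ck_Dif 0))|exact: norm_continuous].
Qed.

Lemma closed_body h : closed (@body R h).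
Proof.
apply: closedI.
  apply: (@closed_comp _ _ (@Kh R) [set x | x <= h]); last exact: closed_le.
  by move=> z _; exact: (Ck_continuous (Ck_Kh 0)).
apply: (@closed_comp _ _ (fun z => `|Dif z| : R) [set x | x <= saddle_sq]); last exact: closed_le.
by move=> z _; apply: continuous_comp; [exact: (Ck_continuous (Ck_Dif 0))|exact: norm_continuous].
Qed.

End Regularity.

Section Convexity.
Variables (R : realType) (h : R).
Hypotheses (h0 : 0 < h) (hc : h <= 8 / 3 * saddle_sq).
Local Notation T := 'rV[R]_(2 + 2).
Implicit Types (z w : T) (s t : R).

(** Multiplies x and u, rather than x and y, by s: this makes K monotone in s on
    the body, while a plain homothety would mix y with the cubic terms. *)
Definition dilate s z : T :=
  vec4 (8 / 3 * (s * z ord0 ix2) ^+ 3 + s * mom1 z)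
       (- (8 / 3 * (s * z ord0 ix1) ^+ 3) + s * mom2 z)
       (s * z ord0 ix1) (s * z ord0 ix2).

Lemma Dif_dilate s z : Dif (dilate s z) = s ^+ 2 * Dif z.
Proof. by rewrite /Dif /dilate !vec4E dif_scale. Qed.

Lemma Kh_dilate s z : Kh (dilate s z) =
  s ^+ 2 * (2^-1 * mom1 z ^+ 2 + 2^-1 * mom2 z ^+ 2)
  + pot (s * z ord0 ix1) (s * z ord0 ix2).
Proof.
rewrite KhE /Pot [mom1 (dilate _ _)]/mom1 [mom2 (dilate _ _)]/mom2 /dilate !vec4E.
by congr (_ + _); ring.
Qed.

Lemma dilate1 z : dilate 1 z = z.
Proof.
by rewrite /dilate /mom1 /mom2 !mul1r; apply: vec4_ext; rewrite !vec4E //; ring.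
Qed.

Lemma dilate0 z : dilate 0 z = 0.
Proof.
rewrite /dilate !mul0r expr0n /= mulr0 addr0 oppr0 addr0.
by rewrite /vec4 !scale0r !addr0.
Qed.

Lemma dilate_inner s z : 0 <= s < 1 -> body h z -> inner_body h (dilate s z).
Proof.
move=> /andP[s0 s1] [Kz dz]; have s2 : s ^+ 2 < 1 by rewrite expr_lt1.
apply: (lt_inner hc); last first.
  rewrite Dif_dilate normrM ger0_norm ?exprn_ge0 //.
  by apply: le_trans dz; rewrite ler_piMl // ltW.
rewrite Kh_dilate; set m := _ + _ * mom2 z ^+ 2.
have m0 : 0 <= m by rewrite addr_ge0 // mulr_ge0 ?sqr_ge0.
have Kz' : m + Pot z <= h by rewrite /m -KhE.
have [x0|x0] := ltP 0 (z ord0 ix1 ^+ 2 + z ord0 ix2 ^+ 2).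
  have := pot_radial (introT andP (conj s0 s1)) dz x0; rewrite -/(Pot z) => ps.
  have : s ^+ 2 * m <= m by rewrite ler_piMl // ltW.
  by move: Kz' ps; clear; lra.
have pe0 : pot (s * z ord0 ix1) (s * z ord0 ix2) <= 0.
  apply: le_trans (pot_radial_le _ dz) _; first by rewrite s0 ltW.
  have xx0 : z ord0 ix1 ^+ 2 + z ord0 ix2 ^+ 2 = 0.
    by apply/eqP; rewrite eq_le x0 addr_ge0 ?sqr_ge0.
  by rewrite /pot xx0 mulr0 mul0r.
have P0 : 0 <= Pot z.
  by apply: le_trans (pot_ge dz); rewrite mulr_ge0 // addr_ge0 ?sqr_ge0.
have : s ^+ 2 * m <= s ^+ 2 * h by rewrite ler_wpM2l ?exprn_ge0 //; move: Kz' P0; clear; lra.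
have : s ^+ 2 * h < h by rewrite gtr_pMl.
by move: pe0; clear; lra.
Qed.

Lemma dilate_outer s z : 1 < s -> shell h z -> ~ body h (dilate s z).
Proof.
move=> s1 [Kz dz] [Ks ds]; have s0 : 0 < s by exact: lt_trans s1.
have sn : s != 0 by rewrite gt_eqF.
have s2 : 1 < s ^+ 2 by rewrite exprn_egt1.
rewrite Dif_dilate -dif_scale in ds; move: Ks; rewrite Kh_dilate; apply/negP; rewrite -ltNge.
rewrite -Kz KhE; set m := _ + _ * mom2 z ^+ 2.
have m0 : 0 <= m by rewrite addr_ge0 // mulr_ge0 ?sqr_ge0.
have ms : m <= s ^+ 2 * m by rewrite ler_peMl // ltW.
have [x0|x0] := ltP 0 (z ord0 ix1 ^+ 2 + z ord0 ix2 ^+ 2).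
  rewrite ler_ltD // /Pot.
  have := @pot_radial R (s * z ord0 ix1) (s * z ord0 ix2) s^-1.
  rewrite !mulKf //; apply=> //; first by rewrite invr_ge0 ltW //= invf_lt1.
  by rewrite !exprMn -mulrDr mulr_gt0 // (lt_trans _ s2).
have xx0 : z ord0 ix1 ^+ 2 + z ord0 ix2 ^+ 2 = 0.
  by apply/eqP; rewrite eq_le x0 addr_ge0 ?sqr_ge0.
have P0 : Pot z = 0 by rewrite /Pot /pot xx0 mulr0 mul0r.
have -> : pot (s * z ord0 ix1) (s * z ord0 ix2) = 0.
  by rewrite /pot !exprMn -mulrDr xx0 !mulr0 mul0r.
rewrite P0 !addr0 ltr_pMl // lt_def m0 andbT.
by move: h0; rewrite -Kz KhE P0 addr0 -/m => /lt0r_neq0.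
Qed.

Lemma Ck_dilate (V : normedModType R) k (f : V -> R) z :
  Ck_on k setT f -> Ck_on k setT (fun v => dilate (f v) z).
Proof.
move=> Cf.
have C1 (i : 'I_(2 + 2)) : Ck_on k setT (fun v => f v * z ord0 i).
  by apply: (@CkM _ _ k f (cst _)) => //; exact: Ck_cst.
apply: Ck_vec4 => //.
- apply: (@CkD _ _ _ k (cst (8 / 3) * (fun v => f v * z ord0 ix2) ^+ 3) (f * cst (mom1 z))).
    by apply: CkM; [exact: Ck_cst|exact: CkX].
  by apply: CkM => //; exact: Ck_cst.
- apply: (@CkD _ _ _ k (- (cst (8 / 3) * (fun v => f v * z ord0 ix1) ^+ 3)) (f * cst (mom2 z))).
    by apply: CkN; apply: CkM; [exact: Ck_cst|exact: CkX].
  by apply: CkM => //; exact: Ck_cst.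
Qed.

Definition seg z0 z1 s t : T := dilate s z0 + t *: (dilate s z1 - dilate s z0).

Lemma continuous_seg z0 z1 : continuous (fun st : R * R => seg z0 z1 st.1 st.2).
Proof.
have C1 : Ck_on 0 setT (fst : R * R -> R).
  by move=> x _; exact: cvg_fst.
have C2 : Ck_on 0 setT (snd : R * R -> R) by move=> x _; exact: cvg_snd.
have Cp z : continuous (fun st : R * R => dilate st.1 z) := Ck_continuous (Ck_dilate z C1).
move=> x.
exact: (continuousD (Cp z0 x) (continuousZ (C2 x I) (continuousB (Cp z1 x) (Cp z0 x)))).
Qed.

Lemma continuous_dilate z : continuous (fun s => dilate s z).
Proof.
have C1 : Ck_on 0 setT (@id R) by move=> x _; exact: cvg_id.
exact: (Ck_continuous (Ck_dilate z C1)).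
Qed.

Lemma closed_seg z0 z1 t : closed [set s | body h (seg z0 z1 s t)].
Proof.
apply: (@closed_comp _ _ (fun s => seg z0 z1 s t) (body h)); last exact: closed_body.
move=> s _; have [c0 c1] := (@continuous_dilate z0 s, @continuous_dilate z1 s).
exact: (cvgD c0 (cvgZ (cvg_cst t) (cvgB c1 c0))).
Qed.

Lemma seg_inner z0 z1 s t : body h z0 -> body h z1 -> 0 <= s < 1 ->
  (forall r, 0 <= r <= 1 -> body h (seg z0 z1 s r)) -> 0 <= t <= 1 ->
  inner_body h (seg z0 z1 s t).
Proof.
move=> b0 b1 s01 segb t01; apply: contrapT => nin.
have [p0 p1] := (dilate_inner s01 b0, dilate_inner s01 b1).
have [Kt dt] := segb t t01.
have Mt : shell h (seg z0 z1 s t).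
  split=> //; apply/eqP; rewrite eq_le Kt leNgt; apply/negP => Klt.
  by apply: nin; exact: (lt_inner hc).
have t0 : t != 0.
  by apply: contra_notN nin => /eqP ->; rewrite /seg scale0r addr0.
have t1 : t != 1.
  by apply: contra_notN nin => /eqP ->; rewrite /seg scale1r addrC subrK.
apply: (no_tangent_segment hc Mt (w := dilate s z1 - dilate s z0)).
  by apply: contra_notN nin => /eqP w0; rewrite /seg w0 scaler0 addr0.
have /andP[tlt0 tlt1] : 0 < t < 1 by rewrite !lt_neqAle t1 eq_sym t0.
exists (Num.min t (1 - t)); first by rewrite /= lt_min subr_gt0 tlt0.
move=> r; rewrite /= sub0r normrN lt_min !ltr_norml => /andP[/andP[r1 r2] /andP[r3 r4]].
rewrite /seg -addrA -scalerDl; apply: segb; apply/andP; split; lra.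
Qed.

(** The set of s for which the whole segment lies in the interior of the body is
    open by compactness of the segment; it is also closed in [0, 1), because by
    [seg_inner] a segment contained in the body is contained in its interior. *)
Lemma seg_all_inner z0 z1 s t : body h z0 -> body h z1 -> 0 <= s < 1 ->
  0 <= t <= 1 -> inner_body h (seg z0 z1 s t).
Proof.
move=> b0 b1 /andP[s0 s1].
pose C := [set r | forall t, `[0, 1]%classic t -> inner_body h (seg z0 z1 r t)].
pose D := [set r | forall t, `[0, 1]%classic t -> body h (seg z0 z1 r t)].
have CD r : C r -> D r by move=> Cr x /Cr [Kx dx]; split; exact: ltW.
have DC r : 0 <= r < 1 -> D r -> C r.
  move=> r01 Dr x; rewrite /= in_itv /= => x01; apply: (seg_inner b0 b1 r01) x01.
  by move=> y y01; apply: Dr; rewrite /= in_itv.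
have oC : open C.
  rewrite openE => r Cr; have /compact_near_coveringP := @segment_compact R 0 1.
  move=> /(_ R (nbhs r) (fun i x => inner_body h (seg z0 z1 i x)) _); apply.
  move=> x /Cr xin.
  have [[A B] /= [nA nB] AB] := @continuous_seg z0 z1 (r, x) (inner_body h)
    (open_nbhs_nbhs (conj (@open_inner R h) xin)).
  by exists (B, A) => // -[a b] /= [Ba Ab]; exact: (AB (b, a)).
have cD : closed D.
  have -> : D = \bigcap_(t in `[0, 1]%classic) [set r | body h (seg z0 z1 r t)].
    by apply/seteqP; split.
  by apply: closed_bigI => x _; exact: closed_seg.
have sin : `[0, s]%classic `&` C = `[0, s]%classic.
  apply: (@segment_connected R 0 s).
  - exists 0; split; first by rewrite /= in_itv /= lexx.
    move=> x _; rewrite /seg !dilate0 subrr scaler0 addr0 -(dilate0 z0).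
    by apply: dilate_inner => //; rewrite lexx ltr01.
  - by exists C.
  - exists D => //; apply/seteqP; split => r [rs]; split => //; first exact: CD.
    apply: DC => //; move: rs; rewrite /= in_itv /= => /andP[-> rs] /=.
    exact: le_lt_trans s1.
move=> t01; have : (`[0, s]%classic `&` C) s by rewrite sin /= in_itv /= s0 lexx.
by move=> [_]; apply; rewrite /= in_itv.
Qed.

Lemma body_convex z0 z1 t : body h z0 -> body h z1 -> 0 <= t <= 1 ->
  body h (z0 + t *: (z1 - z0)).
Proof.
move=> b0 b1 t01; have -> : z0 + t *: (z1 - z0) = seg z0 z1 1 t by rewrite /seg !dilate1.
apply: closed_seg => U /nbhs_ballP[e /= e0 eU].
pose r : R := Num.max 0 (1 - e / 2).
have r01 : 0 <= r < 1 by rewrite le_max lexx /= gt_max ltr01 /= gtrBl divr_gt0.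
exists r; split.
  by have [Kz dz] := seg_all_inner b0 b1 r01 t01; split; exact: ltW.
apply: eU; rewrite -ball_normE /= gtr0_norm ?subr_gt0; last by case/andP: r01.
rewrite ltrBlDl -ltrBlDr /r lt_max; apply/orP; right; lra.
Qed.

Lemma convex_body : convex_set (body h : set (convex_lmodType T)).
Proof.
move=> x y l; rewrite !inE => bx by_.
have -> : conv l x y = y + l%:num *: (x - y) :> T.
  rewrite scalerBr addrC -addrA; congr (_ + _).
  by rewrite /conv /= scalerBl scale1r addrC.
by apply: body_convex => //; rewrite ge0 le1.
Qed.

(** Points of the surface are limits of their dilates by s > 1, which are not in the
    body. *)
Lemma shellE : shell h = closure (body h) `\` (body h)°.
Proof.
rewrite -(closure_id _).1; last exact: closed_body.
apply/seteqP; split => z.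
  move=> Mz; split; first by split; [rewrite Mz.1|exact: Mz.2].
  move=> /= bz.
  have cp := @continuous_dilate z (1 : R).
  have : nbhs (dilate 1 z) (body h) by rewrite dilate1.
  move=> /cp /nbhs_ballP[e /= e0 eU].
  apply: (@dilate_outer (1 + e / 2) z) Mz _; first by rewrite ltrDl divr_gt0.
  apply: eU; rewrite -ball_normE /= opprD addrA subrr sub0r normrN gtr0_norm ?divr_gt0 //.
  by lra.
move=> [bz nz]; split; last exact: bz.2.
apply/eqP; rewrite eq_le bz.1 leNgt; apply/negP => Kz; apply: nz.
have := open_nbhs_nbhs (conj (@open_inner R h) (lt_inner hc Kz bz.2)).
by apply: filterS => w [Kw dw]; split; exact: ltW.
Qed.

Lemma body_coord z : body h z -> [/\ `|mom1 z| <= Num.sqrt (2 * h),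
  `|mom2 z| <= Num.sqrt (2 * h), `|z ord0 ix1| <= Num.sqrt h & `|z ord0 ix2| <= Num.sqrt h].
Proof.
move=> [Kz dz]; have pz := pot_ge dz; rewrite -/(Pot z) in pz.
rewrite KhE in Kz.
have := sqr_ge0 (mom1 z); have := sqr_ge0 (mom2 z).
have := sqr_ge0 (z ord0 ix1); have := sqr_ge0 (z ord0 ix2).
have sq (a b : R) : a ^+ 2 <= b -> `|a| <= Num.sqrt b.
  by move=> ab; rewrite -sqrtr_sqr ler_wsqrtr.
move: pz Kz; move: (mom1 z ^+ 2) (sq (mom1 z)) => m1 s1.
move: (mom2 z ^+ 2) (sq (mom2 z)) => m2 s2.
move: (z ord0 ix1 ^+ 2) (sq (z ord0 ix1)) (z ord0 ix2 ^+ 2) (sq (z ord0 ix2)) (Pot z).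
by move=> x1 s3 x2 s4 P *; split; [apply: s1|apply: s2|apply: s3|apply: s4]; lra.
Qed.

Lemma bounded_body : bounded_set (body h).
Proof.
pose B := Num.sqrt (2 * h) + 8 / 3 * Num.sqrt h ^+ 3 + Num.sqrt h.
have sh : 0 <= Num.sqrt h by exact: sqrtr_ge0.
have s2h : 0 <= Num.sqrt (2 * h) by exact: sqrtr_ge0.
have sh3 : 0 <= Num.sqrt h ^+ 3 by rewrite exprn_ge0.
have B0 : 0 <= B by rewrite !addr_ge0 // mulr_ge0.
exists B; split; first exact: num_real.
move=> M BM z /body_coord[m1 m2 x1 x2].
rewrite /Num.Def.normr /= mx_normrE; apply: bigmax_le => [|[i j] _ /=].
  exact: le_trans B0 (ltW BM).
apply: le_trans (ltW BM); rewrite (ord1 i); move: j {i M BM}.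
have cube (a : R) : `|a| <= Num.sqrt h -> `|8 / 3 * a ^+ 3| <= 8 / 3 * Num.sqrt h ^+ 3.
  move=> ah; rewrite normrM normrX ger0_norm ?divr_ge0 // ler_wpM2l ?divr_ge0 //.
  by rewrite lerXn2r.
apply: ord4P.
- have -> : z ord0 iy1 = mom1 z + 8 / 3 * z ord0 ix2 ^+ 3 by rewrite /mom1 subrK.
  apply: le_trans (ler_normD _ _) _; have := cube _ x2; rewrite /B; lra.
- have -> : z ord0 iy2 = mom2 z - 8 / 3 * z ord0 ix1 ^+ 3 by rewrite /mom2 addrK.
  apply: le_trans (ler_normB _ _) _; have := cube _ x1; rewrite /B; lra.
- by rewrite /B; lra.
- by rewrite /B; lra.
Qed.

End Convexity.

(** * The energy surface is a sphere *)

(** Points of A away from f y have images separated from y; by compactness finitely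
    many such separations suffice. *)
Lemma compact_inverse_continuous (S T : topologicalType) (A : set S) (B : set T)
    (g : S -> T) (f : T -> S) : compact A -> hausdorff_space T ->
  continuous g -> (forall x, A x -> B (g x) /\ f (g x) = x) ->
  (forall y, B y -> A (f y) /\ g (f y) = y) -> {within B, continuous f}.
Proof.
move=> cA hT cg gA fB; apply/subspace_continuousP => y By U nU.
have FB : Filter (within B (nbhs y)) by typeclasses eauto.
have H := (compact_near_coveringP A).1 cA T (within B (nbhs y))
  (fun y' x => B y' -> f y' = x -> U x) FB.
have : nbhs y (fun y' => B y' -> A `<=` (fun x => B y' -> f y' = x -> U x)).
  apply: H => x Ax; have [xy|xy] := pselect (x = f y).
    exists (U, setT) => /=; first by split; [rewrite xy|exact: filterT].
    by move=> [x' y'] /= [].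
  have gxy : g x <> y by move=> gx; apply: xy; rewrite -gx (gA x Ax).2.
  have := hT (g x) y; move=> /contra_not /(_ gxy) /existsNP[N1 /existsNP[N2]].
  move=> /not_implyP[n1 /not_implyP[n2 N12]].
  exists (g @^-1` N1, N2) => /=.
    by split; [exact: cg|apply: filterS n2 => ? ? _].
  move=> [x' y'] /= [N1x N2y] By' fy'; exfalso; apply: N12; exists y'; split => //.
  by rewrite -(fB y' By').2 fy'.
apply: filterS => y' Hy' By' /=.
by apply: (Hy' By' (f y')) => //; exact: (fB y' By').1.
Qed.

Section Sphere.
Variables (R : realType) (h : R).
Hypotheses (h0 : 0 < h) (hc : h <= 8 / 3 * saddle_sq).
Local Notation T := 'rV[R]_(2 + 2).
Implicit Types (z w : T) (s t : R).

(** The factor m such that |m x|^2 = 2 V(x). *)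
Definition stretch z := Num.sqrt (4 * (2 - 3 * Dif z ^+ 2)).

Definition polar z : T := (Num.sqrt (2 * h))^-1 *: vec4 (mom1 z) (mom2 z)
  (stretch z * z ord0 ix1) (stretch z * z ord0 ix2).

Lemma stretch_gt0 z : `|Dif z| <= saddle_sq -> 0 < stretch z.
Proof. by move=> /dif_sqr_le; rewrite -/(Dif z) sqrtr_gt0; lra. Qed.

Lemma stretch_pot z : `|Dif z| <= saddle_sq ->
  (stretch z * z ord0 ix1) ^+ 2 + (stretch z * z ord0 ix2) ^+ 2 = 2 * Pot z.
Proof.
move=> dz; have := dif_sqr_le dz; rewrite -/(Dif z) => dz2.
by rewrite !exprMn -mulrDr sqr_sqrtr; [rewrite /Pot /pot /Dif /dif; ring|lra].
Qed.

Lemma dot4 (u v : T) : dot u v = u ord0 iy1 * v ord0 iy1 + u ord0 iy2 * v ord0 iy2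
  + u ord0 ix1 * v ord0 ix1 + u ord0 ix2 * v ord0 ix2.
Proof.
rewrite /dot big_split_ord /= !big_ord_recl !big_ord0 !addr0 !addrA.
by congr (_ + _ + _ + _); congr (u ord0 _ * v ord0 _); apply/val_inj.
Qed.

Lemma sphere4 (u : T) : euclidean_sphere (n:=3) (u : 'rV[R]_3.+1) <->
  u ord0 iy1 ^+ 2 + u ord0 iy2 ^+ 2 + u ord0 ix1 ^+ 2 + u ord0 ix2 ^+ 2 = 1.
Proof. by have E := dot4 u u; rewrite -!expr2 in E; rewrite -E. Qed.

Lemma continuous_polar : continuous polar.
Proof.
have cc0 (i : 'I_(2 + 2)) : Ck_on 0 [set: T] (fun z => z ord0 i) by exact: Ck_coord.
have cst0 : Ck_on 0 [set: T] stretch.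
  move=> z _; apply: (@continuous_comp _ _ _ (fun z : T => 4 * (2 - 3 * Dif z ^+ 2)) Num.sqrt).
    have := @CkM R _ 0 (cst 4) (cst 2 - cst 3 * (@Dif R) ^+ 2).
    apply=> //; first exact: Ck_cst.
    apply: CkD; first exact: Ck_cst.
    apply: CkN; apply: CkM; first exact: Ck_cst.
    apply: CkX; exact: Ck_Dif.
  exact: sqrt_continuous.
have cm1 : Ck_on 0 [set: T] (@mom1 R).
  apply: (@CkD _ _ _ 0 _ (- (cst (8 / 3) * (fun z : T => z ord0 ix2) ^+ 3))) => //.
  by apply: CkN; apply: CkM; [exact: Ck_cst|exact: CkX].
have cm2 : Ck_on 0 [set: T] (@mom2 R).
  apply: (@CkD _ _ _ 0 _ (cst (8 / 3) * (fun z : T => z ord0 ix1) ^+ 3)) => //.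
  by apply: CkM; [exact: Ck_cst|exact: CkX].
have cv := Ck_continuous (Ck_vec4 cm1 cm2 (CkM cst0 (cc0 ix1)) (CkM cst0 (cc0 ix2))).
by move=> z; exact: (cvgZl_tmp (cv z)).
Qed.

Lemma polar_sphere z : shell h z -> euclidean_sphere (n:=3) (polar z : 'rV[R]_3.+1).
Proof.
move=> [Kz dz]; apply/sphere4; rewrite /polar; set k := (Num.sqrt _)^-1.
have k2 : k ^+ 2 * (2 * h) = 1.
  by rewrite /k exprVn sqr_sqrtr ?mulr_ge0 ?(ltW h0) // mulVf // mulf_neq0 ?gt_eqF.
transitivity (k ^+ 2 * (mom1 z ^+ 2 + mom2 z ^+ 2 +
  ((stretch z * z ord0 ix1) ^+ 2 + (stretch z * z ord0 ix2) ^+ 2))).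
  move: (vec4E (mom1 z) (mom2 z) (stretch z * z ord0 ix1) (stretch z * z ord0 ix2)).
  move: (vec4 _ _ _ _) => v vE.
  rewrite !(mxE _ _ ord0) !vE; ring.
rewrite stretch_pot // -[RHS]k2 -Kz KhE.
by move: (mom1 z) (mom2 z) (Pot z) => m1 m2 P; field.
Qed.

(** Equal images have x-components on the same ray, on which V is strictly
    monotone. *)
Lemma polar_inj z z' : shell h z -> shell h z' -> polar z = polar z' -> z = z'.
Proof.
move=> [Kz dz] [Kz' dz'] /scalerI.
have k0 : (Num.sqrt (2 * h))^-1 != 0 by rewrite invr_eq0 gt_eqF // sqrtr_gt0 mulr_gt0.
move=> /(_ k0) vE.
have coord i := congr1 (fun v : T => v ord0 i) vE.
have := coord iy1; have := coord iy2; have := coord ix1; have := coord ix2.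
rewrite !vec4E => e2 e1 m2 m1 {coord vE}.
have [m m'] := (stretch_gt0 dz, stretch_gt0 dz').
have PP : Pot z = Pot z' by have := stretch_pot dz; rewrite e1 e2 stretch_pot //; lra.
wlog le_m : z z' Kz dz Kz' dz' e1 e2 m1 m2 m m' PP {k0} / stretch z <= stretch z'.
  move=> H; have [le|/ltW le] := leP (stretch z) (stretch z').
    exact: H.
  by apply/esym; apply: H.
pose s := stretch z / stretch z'.
have s0 : 0 < s by rewrite divr_gt0.
have x1 : z' ord0 ix1 = s * z ord0 ix1.
  by rewrite /s mulrAC e1 mulrAC divff ?mul1r // gt_eqF.
have x2 : z' ord0 ix2 = s * z ord0 ix2.
  by rewrite /s mulrAC e2 mulrAC divff ?mul1r // gt_eqF.
have s1 : s <= 1 by rewrite ler_pdivrMr // mul1r.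
have [xx1 xx2] : z ord0 ix1 = z' ord0 ix1 /\ z ord0 ix2 = z' ord0 ix2.
  move: s1; rewrite le_eqVlt => /predU1P[s1|s1]; first by rewrite x1 x2 s1 !mul1r.
  have [x0|x0] := ltP 0 (z ord0 ix1 ^+ 2 + z ord0 ix2 ^+ 2).
    have := pot_radial (introT andP (conj (ltW s0) s1)) dz x0.
    by rewrite -x1 -x2 -/(Pot z) -/(Pot z') PP ltxx.
  have x10 : z ord0 ix1 = 0.
    apply/eqP; rewrite -sqrf_eq0 eq_le sqr_ge0 andbT.
    by apply: le_trans x0; rewrite lerDl sqr_ge0.
  have x20 : z ord0 ix2 = 0.
    apply/eqP; rewrite -sqrf_eq0 eq_le sqr_ge0 andbT.
    by apply: le_trans x0; rewrite lerDr sqr_ge0.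
  by rewrite x1 x2 x10 x20 !mulr0.
apply: vec4_ext => //.
  by move: m1; rewrite /mom1 xx2 => /addIr.
by move: m2; rewrite /mom2 xx1 => /addIr.
Qed.

(** On the ray through the prescribed direction V takes the prescribed value, by
    the intermediate value theorem up to the edge of the strip. *)
Lemma polar_surj (u : T) : euclidean_sphere (n:=3) (u : 'rV[R]_3.+1) ->
  exists2 z, shell h z & polar z = u.
Proof.
move=> /sphere4; pose k := Num.sqrt (2 * h); have k0 : 0 < k by rewrite sqrtr_gt0 mulr_gt0.
have k2 : k ^+ 2 = 2 * h by rewrite sqr_sqrtr // mulr_ge0 // ltW.
pose v := k *: u; have vE i : v ord0 i = k * u ord0 i by rewrite mxE.
move=> u1; have {u1} : v ord0 iy1 ^+ 2 + v ord0 iy2 ^+ 2 + v ord0 ix1 ^+ 2 + v ord0 ix2 ^+ 2 = 2 * h.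
  by rewrite !vE !exprMn -!mulrDr u1 k2 mulr1.
set a := v ord0 iy1; set b := v ord0 iy2; set x1 := v ord0 ix1; set x2 := v ord0 ix2 => vh.
suff [r [r0 dr pr]] : exists r, [/\ 0 <= r, `|dif (r * x1) (r * x2)| <= saddle_sq &
    2 * pot (r * x1) (r * x2) = x1 ^+ 2 + x2 ^+ 2].
  pose z := vec4 (a + 8 / 3 * (r * x2) ^+ 3) (b - 8 / 3 * (r * x1) ^+ 3) (r * x1) (r * x2).
  have zE := vec4E (a + 8 / 3 * (r * x2) ^+ 3) (b - 8 / 3 * (r * x1) ^+ 3) (r * x1) (r * x2).
  have [zx1 zx2] : z ord0 ix1 = r * x1 /\ z ord0 ix2 = r * x2 by rewrite /z !zE.
  have dz : `|Dif z| <= saddle_sq by rewrite /Dif zx1 zx2.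
  have m1 : mom1 z = a by rewrite /mom1 /z !zE addrK.
  have m2 : mom2 z = b by rewrite /mom2 /z !zE subrK.
  have Pz : 2 * Pot z = x1 ^+ 2 + x2 ^+ 2 by rewrite /Pot /z !zE.
  exists z.
    by split=> //; rewrite KhE m1 m2; move: vh; rewrite -addrA -Pz; move: (Pot z) => P *; lra.
  have sr : x1 ^+ 2 + x2 ^+ 2 != 0 -> stretch z * r = 1.
    move=> x0; apply/eqP; rewrite -(@eqrXn2 _ 2) ?mulr_ge0 ?sqrtr_ge0 // expr1n.
    apply/eqP; apply: (mulIf x0); rewrite mul1r.
    have := stretch_pot dz; rewrite Pz zx1 zx2; move: (stretch z) => m H.
    by rewrite -[RHS]H; ring.
  have sx (x : R) : (x1 ^+ 2 + x2 ^+ 2 = 0 -> x = 0) -> stretch z * (r * x) = x.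
    move=> xx; have [/xx->|/sr e] := eqVneq (x1 ^+ 2 + x2 ^+ 2) 0; first by rewrite !mulr0.
    by rewrite mulrA e mul1r.
  have -> : u = k^-1 *: v by rewrite /v scalerA mulVf ?scale1r // gt_eqF.
  rewrite /polar -/k; congr (_ *: _); rewrite m1 m2 zx1 zx2.
  apply: vec4_ext; rewrite !vec4E //; apply: sx => xx0.
    by apply/eqP; rewrite -sqrf_eq0 eq_le sqr_ge0 andbT -xx0 lerDl sqr_ge0.
  by apply/eqP; rewrite -sqrf_eq0 eq_le sqr_ge0 andbT -xx0 lerDr sqr_ge0.
have c0 := @saddle_sq_gt0 R.
(* r1 is where the ray meets the edge of the strip, but at most 1, where V is already
   large enough *)
pose D := Num.max `|dif x1 x2| saddle_sq; have D0 : 0 < D by rewrite lt_max c0 orbT.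
pose r1 := Num.sqrt (saddle_sq / D).
have r10 : 0 < r1 by rewrite sqrtr_gt0 divr_gt0.
have r12 : r1 ^+ 2 = saddle_sq / D by rewrite sqr_sqrtr // divr_ge0 // ltW.
have dr r : 0 <= r <= r1 -> `|dif (r * x1) (r * x2)| <= saddle_sq.
  move=> /andP[r0 rr1]; rewrite dif_scale normrM ger0_norm ?exprn_ge0 //.
  apply: (@le_trans _ _ (saddle_sq / D * D)); last by rewrite divfK // gt_eqF.
  rewrite ler_pM ?exprn_ge0 // -?r12 ?lerXn2r ?nnegrE // ?(ltW r10) //.
  by rewrite le_max lexx.
pose F := fun r => 2 * pot (r * x1) (r * x2).
have xh : x1 ^+ 2 + x2 ^+ 2 <= 2 * h.
  by rewrite -vh -addrA lerDr addr_ge0 // sqr_ge0.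
have Fr1 : x1 ^+ 2 + x2 ^+ 2 <= F r1.
  have r11 : 0 <= r1 <= r1 by rewrite lexx ltW.
  have [dc|dc] := leP `|dif x1 x2| saddle_sq.
    have DE : D = saddle_sq by rewrite /D max_r.
    have r1E : r1 = 1 by rewrite /r1 DE divff ?sqrtr1 // gt_eqF.
    rewrite /F r1E !mul1r; have := pot_ge dc.
    have := sqr_ge0 x1; have := sqr_ge0 x2; clear; lra.
  have DE : D = `|dif x1 x2| by rewrite /D max_l // ltW.
  have : `|dif (r1 * x1) (r1 * x2)| = saddle_sq.
    rewrite dif_scale normrM ger0_norm ?exprn_ge0 ?(ltW r10) // r12 DE divfK //.
    by rewrite gt_eqF // (lt_trans c0).
  move=> /pot_edge; rewrite /F; move: xh hc; clear; lra.
have cF : continuous F.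
  have Fd r : derivable F r 1.
    rewrite /F /pot; apply: (@ex_derive _ _ _ _ _ _ _ _).
  by move=> r; apply: differentiable_continuous; apply/derivable1_diffP.
have X0 : 0 <= x1 ^+ 2 + x2 ^+ 2 by rewrite addr_ge0 ?sqr_ge0.
have FB : Num.min (F 0) (F r1) <= x1 ^+ 2 + x2 ^+ 2 <= Num.max (F 0) (F r1).
  have -> : F 0 = 0 by rewrite /F /pot; ring.
  by rewrite ge_min X0 le_max Fr1 orbT.
have [r r01 Fr] := IVT (ltW r10) (continuous_subspaceT cF) FB.
exists r; split => //; last by apply: dr; move: r01; rewrite in_itv.
by move: r01; rewrite in_itv /= => /andP[].
Qed.

Lemma shell_sphere : homeomorphic (@euclidean_sphere R 3) (shell h : set 'rV[R]_4).
Proof.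
have cM : compact (shell h).
  apply: bounded_closed_compact.
    have [M [Mr MB]] := @bounded_body R h.
    exists M; split=> // x Mx z Mz; apply: (MB x Mx z).
    by split; [rewrite Mz.1|exact: Mz.2].
  have -> : shell h = body h `&` ~` (inner_body h).
    apply/seteqP; split => z.
      by move=> [Kz dz]; split; [split=> //; rewrite Kz|move=> [Kz' _]; move: Kz'; rewrite Kz ltxx].
    move=> [[Kz dz] nz]; split=> //; apply/eqP; rewrite eq_le Kz leNgt; apply/negP => Kz'.
    by apply: nz; exact: (lt_inner hc).
  by apply: closedI; [exact: closed_body|apply: open_closedC; exact: open_inner].
have inv (u : T) : exists z, euclidean_sphere (n:=3) (u : 'rV[R]_3.+1) ->
    shell h z /\ polar z = u.
  have [su|nsu] := pselect (euclidean_sphere (n:=3) (u : 'rV[R]_3.+1)).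
    by have [z Mz pz] := polar_surj su; exists z.
  by exists 0.
have [f fP] := choice inv.
exists f, polar; split.
- apply: (@compact_inverse_continuous _ _ (shell h) (@euclidean_sphere R 3) polar f cM).
  + exact: norm_hausdorff.
  + exact: continuous_polar.
  + move=> z Mz; have sp := polar_sphere Mz; split => //.
    by have [Mf pf] := fP _ sp; apply: polar_inj.
  + by move=> u /fP.
- by apply: continuous_subspaceT => z; exact: continuous_polar.
- by move=> u /fP.
- move=> z Mz; have sp := polar_sphere Mz; split => //.
  by have [Mf pf] := fP _ sp; apply: polar_inj.
Qed.

End Sphere.

(** * Energy levels and the Hill region *)

Section Level.
Variable R : realType.
Implicit Types E : R.

Lemma level_gt0 E : E <= E_crit R -> 0 < level E.
Proof.
move=> Ec; rewrite /level divr_gt0 // powR_gt0 // normr_gt0.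
by rewrite lt_eqF // (le_lt_trans Ec) // oppr_lt0.
Qed.

Lemma level_crit : level (E_crit R) = 8 / 3 * saddle_sq.
Proof.
have l0 := level_gt0 (lexx (E_crit R)); have c0 := @saddle_sq_gt0 R.
apply/eqP; rewrite -(@eqrXn2 _ 2) // ?(ltW l0) ?mulr_ge0 ?(ltW c0) //.
apply/eqP; rewrite [RHS]exprMn sqr_saddle_sq /level.
have a0 : 0 <= `|E_crit R| by [].
have pE : (`|E_crit R| `^ (3 / 2)) ^+ 2 = `|E_crit R| ^+ 3.
  rewrite -[LHS]powR_mulrn ?powR_ge0 // -powRrM -[RHS]powR_mulrn //.
  by congr (_ `^ _); field.
rewrite exprMn exprVn pE.
by rewrite /E_crit normrN ger0_norm ?divr_ge0 //; field.
Qed.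

Lemma level_lt E : E < E_crit R -> level E < 8 / 3 * saddle_sq.
Proof.
move=> Ec; rewrite -level_crit /level ltr_pM2l // ltf_pV2 ?posrE ?powR_gt0 ?normr_gt0 //.
- rewrite gt0_ltr_powR ?nnegrE ?divr_gt0 //.
  have E0 : E_crit R < 0 by rewrite oppr_lt0.
  by rewrite !ltr0_norm ?ltrN2 // (lt_trans Ec).
- by rewrite lt_eqF // (lt_trans Ec) // oppr_lt0.
- by rewrite lt_eqF // oppr_lt0.
Qed.

Lemma level_le E : E <= E_crit R -> level E <= 8 / 3 * saddle_sq.
Proof. by rewrite le_eqVlt => /predU1P[->|/level_lt/ltW//]; rewrite level_crit. Qed.

End Level.

Section HillRegion.
Variable R : realType.
Local Notation P := 'rV[R]_2.
Implicit Types x : P.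

Definition pot2 x := pot (fst2 x) (snd2 x).
Definition dif2 x := dif (fst2 x) (snd2 x).

Lemma potentialE x : potential x = pot2 x.
Proof.
rewrite /potential /pot2 /pot /dot !big_ord_recl big_ord0 addr0 -!expr2.
by congr (_ * (_ + _ ^+ 2) * _); congr (x _ _); apply/val_inj.
Qed.

Lemma pot2Z s x : pot2 (s *: x) = pot (s * fst2 x) (s * snd2 x).
Proof. by rewrite /pot2 /fst2 /snd2 !mxE. Qed.

Lemma dif2Z s x : dif2 (s *: x) = s ^+ 2 * dif2 x.
Proof. by rewrite /dif2 -dif_scale /fst2 /snd2 !mxE. Qed.

Lemma continuous_dif2 : continuous dif2.
Proof.
have -> : dif2 = (@fst2 R) ^+ 2 - (@snd2 R) ^+ 2 by apply/funext.
by apply: Ck_continuous; apply: CkD; [|apply: CkN]; apply: CkX; exact: Ck_coord.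
Qed.

Lemma continuous_pot2 : continuous pot2.
Proof.
have -> : pot2 = cst 2 * ((@fst2 R) ^+ 2 + (@snd2 R) ^+ 2)
    * (cst 2 - cst 3 * ((@fst2 R) ^+ 2 - (@snd2 R) ^+ 2) ^+ 2) by apply/funext.
have [c1 c2] : Ck_on 0 setT (@fst2 R) /\ Ck_on 0 setT (@snd2 R) by split; exact: Ck_coord.
apply: Ck_continuous.
by repeat first [exact: Ck_cst | assumption | apply: CkX | apply: CkN | apply: CkM
  | apply: CkD].
Qed.

Lemma continuous_ray x : continuous (fun s : R => s *: x).
Proof. by move=> s; apply: cvgZr_tmp; exact: cvg_id. Qed.

(** A connected set that leaves the strip must cross its edge, where the potential
    reaches the critical value; conversely the sublevel set in the strip is
    star-shaped about the origin. *)
Lemma component_origin (Q : set R) :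
  (forall a b, a <= b -> Q b -> Q a) -> Q 0 -> ~ Q (8 / 3 * saddle_sq) ->
  connected_component [set x | Q (pot2 x)] 0 =
  [set x | Q (pot2 x) /\ `|dif2 x| < saddle_sq].
Proof.
move=> Qle Q0 Qc; set A := [set x | Q (pot2 x)].
have pot20 : pot2 0 = 0 by rewrite /pot2 /pot /fst2 /snd2 !mxE; ring.
have dif20 : dif2 0 = 0 by rewrite /dif2 /dif /fst2 /snd2 !mxE; ring.
apply/seteqP; split => x.
  move=> Cx; split; first exact: (connected_component_sub Cx).
  rewrite ltNge; apply/negP => cx.
  set C := connected_component A 0 in Cx.
  have cC : connected ((fun y => `|dif2 y|) @` C).
    apply: connected_continuous_connected; first exact: component_connected.
    apply: continuous_subspaceT => y; apply: continuous_comp; first exact: continuous_dif2.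
    exact: norm_continuous.
  have C0 : C 0 by apply: connected_component_refl; rewrite /A /= pot20.
  have /connected_intervalP/(_ 0 `|dif2 x|) := cC.
  move=> /(_ (ex_intro2 _ _ 0 C0 _) (ex_intro2 _ _ x Cx (erefl _)) saddle_sq) [].
  - by rewrite dif20 normr0.
  - by rewrite cx ltW // saddle_sq_gt0.
  move=> w Cw dw; apply: Qc; have := connected_component_sub Cw; rewrite /A /=.
  by apply: Qle; exact: pot_edge.
move=> [Qx dx].
apply: (@connected_component_max _ A ((fun s : R => s *: x) @` `[0, 1]%classic)).
- by exists 0; rewrite ?scale0r //= in_itv /= lexx ler01.
- move=> _ [s s01 <-]; rewrite /A /= pot2Z; apply: Qle Qx.
  by apply: pot_radial_le; [move: s01; rewrite /= in_itv|exact: ltW].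
- apply: connected_continuous_connected; first exact: segment_connected.
  by apply: continuous_subspaceT => s; exact: continuous_ray.
by exists 1; rewrite ?scale1r //= in_itv /= lexx ler01.
Qed.

(** Below the critical level the strict inequality on the edge is automatic.  At the
    critical level the closure adds the missing boundary points, which are limits
    along rays. *)
Lemma hill_regionE (E : R) : E <= E_crit R ->
  hill_region E = [set x | pot2 x <= level E /\ `|dif2 x| <= saddle_sq].
Proof.
move=> Ec; have h0 := level_gt0 Ec; rewrite /hill_region; case: ifPn => [Elt|].
  have -> : [set x | potential x <= level E] = [set x | [set a | a <= level E] (pot2 x)].
    by apply/funext => x; rewrite /= potentialE.
  rewrite component_origin //=; first last.
  - by apply/negP; rewrite -ltNge level_lt.
  - exact: ltW.
  - by move=> a b ab; exact: le_trans.
  apply/seteqP; split => x [px dx]; split => //; first exact: ltW.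
  rewrite lt_neqAle dx andbT; apply/eqP => de.
  by have := le_lt_trans (le_trans (pot_edge de) px) (level_lt Elt); rewrite ltxx.
rewrite -leNgt => Ege; have {Ege}EE : E = E_crit R by apply/eqP; rewrite eq_le Ec Ege.
rewrite EE level_crit in h0 *.
have -> : [set x | potential x < 8 / 3 * saddle_sq] = [set x | [set a | a < 8 / 3 * saddle_sq] (pot2 x)].
  by apply/funext => x; rewrite /= potentialE.
rewrite component_origin //=; first last.
- by rewrite ltxx.
- by move=> a b ab; exact: le_lt_trans.
apply/seteqP; split.
  have cB : closed [set x | pot2 x <= 8 / 3 * saddle_sq /\ `|dif2 x| <= saddle_sq].
    apply: closedI.
      apply: (@closed_comp _ _ pot2 [set a | a <= 8 / 3 * saddle_sq]); last exact: closed_le.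
      by move=> x _; exact: continuous_pot2.
    apply: (@closed_comp _ _ (fun x => `|dif2 x|) [set a | a <= saddle_sq]); last exact: closed_le.
    by move=> x _; apply: continuous_comp; [exact: continuous_dif2|exact: norm_continuous].
  by rewrite [X in _ `<=` X](closure_id _).1 //; apply: closure_subset => x [px dx]; split; exact: ltW.
move=> x [px dx] U nU.
have : nbhs (1 *: x) U by rewrite scale1r.
move=> /continuous_ray /nbhs_ballP[e /= e0 eU].
pose s : R := Num.max 0 (1 - e / 2).
have s0 : 0 <= s by rewrite le_max lexx.
have s1 : s < 1 by rewrite gt_max ltr01 /= gtrBl divr_gt0.
exists (s *: x); split; last first.
  apply: eU; rewrite -ball_normE /= gtr0_norm ?subr_gt0 //.
  by rewrite ltrBlDl -ltrBlDr /s lt_max; apply/orP; right; lra.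
have c0 := @saddle_sq_gt0 R; have s2 : s ^+ 2 < 1 by rewrite expr_lt1.
split; last first.
  rewrite dif2Z normrM ger0_norm ?exprn_ge0 //.
  apply: (@le_lt_trans _ _ (s ^+ 2 * saddle_sq)); first by rewrite ler_wpM2l ?exprn_ge0.
  by rewrite gtr_pMl.
rewrite pot2Z; have [x0|x0] := ltP 0 (fst2 x ^+ 2 + snd2 x ^+ 2).
  by apply: lt_le_trans px; apply: pot_radial => //; rewrite s0.
have xx0 : fst2 x ^+ 2 + snd2 x ^+ 2 = 0.
  by apply/eqP; rewrite eq_le x0 addr_ge0 ?sqr_ge0.
by rewrite /pot !exprMn -mulrDr xx0 !mulr0 mul0r.
Qed.

End HillRegion.

(** * Regular points, corners and curvature *)

Section Forms.
Variable R : realType.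
Local Notation T := 'rV[R]_(2 + 2).
Implicit Types (z w p : T) (h : R).

Definition gradK p : T :=
  vec4 (mom1 p) (mom2 p)
    (8 * p ord0 ix1 ^+ 2 * mom2 p + pot1 (p ord0 ix1) (p ord0 ix2))
    (- (8 * p ord0 ix2 ^+ 2 * mom1 p) + pot1 (p ord0 ix2) (p ord0 ix1)).

Lemma dK_dot p w : dK p w = dot (gradK p) w.
Proof.
rewrite dot4 /gradK !vec4E /dK /dkhat -/(mom1 p) -/(mom2 p).
by move: (mom1 p) (mom2 p) (pot1 _ _) (pot1 _ _) => *; ring.
Qed.

Lemma gradK_neq0 p : `|Dif p| < saddle_sq -> 0 < Kh p -> gradK p != 0.
Proof.
move=> dp Kp; apply: contraTneq Kp => g0; rewrite -leNgt /Kh dkhat_eq0 // => e1 e2 w1 w2.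
have := dK_dot p (vec4 e1 e2 w1 w2); rewrite g0 dotE mul0mx mxE => <-.
by rewrite /dK !vec4E.
Qed.

Lemma gradK_corner p : corner p -> gradK p = 0.
Proof.
move=> [m1 m2 cp]; apply: vec4_ext; rewrite /gradK !vec4E ?m1 ?m2 ?mulr0 ?oppr0 ?add0r [RHS]mxE //.
  case: cp => -[x1 x2]; rewrite /pot1 ?x2; last by rewrite x1; ring.
  transitivity (4 * p ord0 ix1 * (2 - 9 * (p ord0 ix1 ^+ 2) ^+ 2)); first by ring.
  by rewrite x1 sqr_saddle_sq; field.
case: cp => -[x1 x2]; rewrite /pot1 ?x1; first by rewrite x2; ring.
transitivity (4 * p ord0 ix2 * (2 - 9 * (p ord0 ix2 ^+ 2) ^+ 2)); first by ring.
by rewrite x2 sqr_saddle_sq; field.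
Qed.

Lemma hKC p w w' : hK p w w' = hK p w' w.
Proof. by rewrite /hK /hkhat; ring. Qed.

Lemma hK_linear p (a : R) w1 w2 w' :
  hK p (a *: w1 + w2) w' = a * hK p w1 w' + hK p w2 w'.
Proof.
rewrite /hK !(mxE _ _ ord0) /hkhat.
by move: (pot11 _ _) (pot12 _ _) (pot11 _ _) => *; ring.
Qed.

Lemma hK_sum p w' n (c : 'I_n -> R) (X : 'I_n -> T) :
  hK p (\sum_i c i *: X i) w' = \sum_i c i * hK p (X i) w'.
Proof.
have h0 : hK p 0 w' = 0.
  by have := hK_linear p 1 0 0 w'; rewrite scale1r addr0 mul1r => /eqP;
    rewrite -subr_eq0 opprD addrA subrr sub0r oppr_eq0 => /eqP.
apply: (big_rec2 (fun a b => hK p a w' = b)) => // i b a _ <-.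
by rewrite hK_linear.
Qed.

End Forms.

Section Curves.
Variables (R : realType) (h : R).
Local Notation T := 'rV[R]_(2 + 2).
Variables (U : set 'rV[R]_3) (phi : 'rV[R]_3 -> T).
Hypotheses (oU : open U) (sphi : smooth_on U phi) (hphi : forall x, U x -> Kh (phi x) = h).

Lemma dK_param x v : U x -> dK (phi x) ('D_v phi x) = 0.
Proof.
move=> Ux; have dphi : differentiable phi x by exact: smooth_on_differentiable Ux.
have d := is_derive_khat (is_derive_coord v iy1 dphi) (is_derive_coord v iy2 dphi)
  (is_derive_coord v ix1 dphi) (is_derive_coord v ix2 dphi).
rewrite -[LHS](@derive_val _ _ _ _ _ _ _ d) -(derive_cst h x v).
apply: near_eq_derive; near=> y; rewrite -[LHS]/(Kh (phi y)) hphi //.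
by near: y; exact: open_nbhs_nbhs.
Unshelve. all: by end_near. Qed.

(** Differentiating K o phi = h twice. *)
Lemma hK_param x v w : U x ->
  hK (phi x) ('D_w phi x) ('D_v phi x) + dK (phi x) ('D_w ('D_v phi) x) = 0.
Proof.
move=> Ux; have dphi : differentiable phi x by exact: smooth_on_differentiable Ux.
have dphi2 : differentiable ('D_v phi) x.
  by apply: smooth_on_differentiable Ux; exact: smooth_on_derive.
have d := is_derive_dkhat (is_derive_coord w iy1 dphi) (is_derive_coord w iy2 dphi)
  (is_derive_coord w ix1 dphi) (is_derive_coord w ix2 dphi)
  (is_derive_coord w iy1 dphi2) (is_derive_coord w iy2 dphi2)
  (is_derive_coord w ix1 dphi2) (is_derive_coord w ix2 dphi2).
rewrite hKC -[LHS](@derive_val _ _ _ _ _ _ _ d) -(derive_cst (0 : R) x w).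
apply: near_eq_derive; near=> y; rewrite -[LHS]/(dK (phi y) ('D_v phi y)) dK_param //.
by near: y; exact: open_nbhs_nbhs.
Unshelve. all: by end_near. Qed.

End Curves.

Section ShellConvexity.
Variables (R : realType) (h : R).
Hypotheses (h0 : 0 < h) (hc : h <= 8 / 3 * saddle_sq).
Local Notation T := 'rV[R]_(2 + 2).
Implicit Types (z w p : T).

Lemma shell_body z : shell h z -> body h z.
Proof. by move=> [Kz dz]; split; rewrite ?Kz. Qed.

Lemma shell_dichotomy z : shell h z -> `|Dif z| < saddle_sq \/ corner z.
Proof.
move=> Mz; have [dz|dz] := ltP `|Dif z| saddle_sq; [by left|right].
have dE : `|Dif z| = saddle_sq by apply/eqP; rewrite eq_le dz Mz.2.
by have [] := edge_corner hc (shell_body Mz) dE.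
Qed.

Lemma finite_corner : finite_set [set z : T | corner z].
Proof.
pose r : R := Num.sqrt saddle_sq.
pose c1 x : T := vec4 0 (- (8 / 3 * x ^+ 3)) x 0.
pose c2 x : T := vec4 (8 / 3 * x ^+ 3) 0 0 x.
apply: (@sub_finite_set _ _ [set` [:: c1 r; c1 (- r); c2 r; c2 (- r)]]); last first.
  exact: finite_seq.
have sq (a : R) : a ^+ 2 = saddle_sq -> a = r \/ a = - r.
  move=> a2; have : a ^+ 2 == r ^+ 2 by rewrite a2 sqr_sqrtr // ltW // saddle_sq_gt0.
  by rewrite eqf_sqr => /orP[] /eqP; [left|right].
move=> z [m1 m2 cz]; rewrite /= !inE.
case: cz => -[x1 x2].
  have zE : z = c1 (z ord0 ix1).
    apply: vec4_ext; rewrite /c1 !vec4E //.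
      by move: m1; rewrite /mom1 x2 expr0n /= mulr0 subr0.
    by move/eqP: m2; rewrite /mom2 addr_eq0 => /eqP.
  by rewrite zE; have [->|->] := sq _ x1; rewrite eqxx ?orbT.
have zE : z = c2 (z ord0 ix2).
  apply: vec4_ext; rewrite /c2 !vec4E //.
    by move/eqP: m1; rewrite /mom1 subr_eq0 => /eqP.
  by move: m2; rewrite /mom2 x1 expr0n /= mulr0 addr0.
by rewrite zE; have [->|->] := sq _ x2; rewrite eqxx ?orbT.
Qed.

Lemma is_derive_Kh z w : is_derive z w (@Kh R) (dK z w).
Proof.
have d := is_derive_proj z w.
exact: is_derive_khat (d iy1) (d iy2) (d ix1) (d ix2).
Qed.

(** Off the saddles K - h is a local equation: by [gradK_neq0] its gradient can vanish
    in the open strip only where K <= 0. *)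
Lemma shell_regular p : shell h p -> `|Dif p| < saddle_sq ->
  regular_point (n:=3) (shell h) p.
Proof.
move=> Mp dp; split=> //.
(* K > 0 on W excludes the critical point at the origin *)
pose W := [set z : T | `|Dif z| < saddle_sq] `&` [set z | 0 < Kh z].
exists W, (fun z => Kh z - h); split.
- apply: openI.
    apply: (@open_comp _ _ (fun z => `|Dif z| : R) [set x | x < saddle_sq]); last exact: open_lt.
    move=> z _; apply: continuous_comp; last exact: norm_continuous.
    exact: (Ck_continuous (Ck_Dif R 0)).
  apply: (@open_comp _ _ (@Kh R) [set x | 0 < x]); last exact: open_gt.
  by move=> z _; exact: (Ck_continuous (Ck_Kh R 0)).
- by split=> //=; rewrite Mp.1.
- move=> k; apply: (@Ck_on_subset _ _ _ _ [set: T]) => //.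
  by apply: (@CkD _ _ _ k (@Kh R) (cst (- h))); [exact: Ck_Kh|exact: Ck_cst].
- move=> z [/= dz Kz]; have -> : grad (fun z => Kh z - h) z = gradK z.
    apply/rowP => i; rewrite mxE; have := is_deriveB
      (is_derive_Kh z (delta_mx ord0 i)) (is_derive_cst h z (delta_mx ord0 i)).
    rewrite subr0 => /(@derive_val _ _ _ _ _ _ _) ->.
    by rewrite dK_dot dotC dotE -rowE !mxE.
  exact: gradK_neq0.
apply/seteqP; split => z.
  by move=> [[Kz dz] Wz]; split => //; rewrite Kz subrr.
move=> [Wz /eqP]; rewrite subr_eq0 => /eqP Kz; split => //; split => //.
by apply: ltW; case: Wz.
Qed.

Lemma singular_shell : finite_set (singular_points (n:=3) (shell h)).
Proof.
apply: sub_finite_set finite_corner => z [Mz nreg].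
by have [dz|//] := shell_dichotomy Mz; exfalso; apply: nreg; exact: shell_regular.
Qed.

(** Off the saddles, [hK_param] identifies minus the product of the gradient with the
    second derivatives of phi with the Hessian of K.  Over a saddle the gradient
    vanishes, so the Hessian of K vanishes on the three-dimensional image of the
    differential of phi, which contains vectors satisfying the condition of
    [hK_corner_gt0]. *)
Lemma shell_curved p : positively_curved_at (n:=3) (shell h) p.
Proof.
move=> U phi u a b [oU sphi iphi Mphi] Uu _ fab.
have hphi x : U x -> Kh (phi x : T) = h by move=> /Mphi [].
have dphi : differentiable phi u by exact: smooth_on_differentiable Uu.
have Mu := Mphi u Uu.
have Dn c : c != 0 -> 'D_c phi u != 0.
  move=> c0; rewrite deriveE //; apply: contra_neq c0 => pc0.
  by apply: (iphi u Uu); rewrite linear0.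
have [dz|cz] := shell_dichotomy Mu.
  apply: (sectional_curvature_gt0 oU sphi iphi Uu (nu := gradK (phi u : T))) fab.
  - by apply: gradK_neq0 => //; rewrite hphi.
  - by move=> i; rewrite -[LHS](dK_dot (phi u : T)); exact: (dK_param oU sphi hphi).
  move=> c c0; set S := matrix_of_fun _ _.
  have SE i j : S i j = hK (phi u : T) ('D_(basis_vec R i) phi u) ('D_(basis_vec R j) phi u).
    rewrite mxE; have := hK_param oU sphi hphi (basis_vec R j) (basis_vec R i) Uu.
    by rewrite [X in _ + X](dK_dot (phi u : T)) => /eqP; rewrite addr_eq0 => /eqP ->.
  have cE := derive_sum_basis dphi c.
  have -> : qform S c c = hK (phi u : T) ('D_c phi u) ('D_c phi u).
    rewrite {1}cE hK_sum; apply: eq_bigr => i _.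
    rewrite hKC cE hK_sum mulr_sumr; apply: eq_bigr => j _.
    by rewrite SE [hK _ _ ('D_(basis_vec R i) phi u)]hKC; ring.
  apply: (hK_gt0 hc Mu dz); last exact: Dn.
  exact: (dK_param oU sphi hphi).
exfalso.
pose L : 'cV[R]_3 := \col_i ((phi u : T) ord0 ix1 * ('D_(basis_vec R i) phi u : T) ord0 ix1
  - (phi u : T) ord0 ix2 * ('D_(basis_vec R i) phi u : T) ord0 ix2).
have [c c0 cL] : exists2 c : 'rV[R]_3, c != 0 & c *m L = 0.
  have /rowV0Pn[c /sub_kermxP cL c0] : kermx L != 0.
    rewrite -mxrank_eq0 mxrank_ker -lt0n subn_gt0.
    exact: leq_ltn_trans (rank_leq_col L) _.
  by exists c.
have cE := derive_sum_basis dphi c.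
have := hK_param oU sphi hphi c c Uu; rewrite [X in _ + X](dK_dot (phi u : T)).
rewrite gradK_corner // dotE mul0mx mxE addr0 => hK0.
suff : 0 < hK (phi u : T) ('D_c phi u) ('D_c phi u) by rewrite hK0 ltxx.
apply: hK_corner_gt0 cz _ (Dn c c0).
have := congr1 (fun M : 'rV_1 => M ord0 ord0) cL; rewrite !mxE => <-.
rewrite cE !summxE !mulr_sumr -sumrB; apply: eq_bigr => i _.
by rewrite !mxE; ring.
Qed.

Lemma shell_strictly_convex : strictly_convex (shell h : set 'rV[R]_4).
Proof.
split.
- exact: shell_sphere.
- exact: singular_shell.
- exists (body h); split; [exact: convex_body|exact: bounded_body|exact: shellE].
- by move=> p _; exact: shell_curved.
Qed.

End ShellConvexity.

(** * The symplectic shear *)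

Section Shear.
Variable R : realType.
Local Notation T := 'rV[R]_(2 + 2).
Implicit Types (z u v : T).

Definition shear_coef x1 x2 : R := 2 * x1 ^+ 2 * x2 - 2 / 3 * x2 ^+ 3.

(** The factor a makes the inverse a member of the same family. *)
Definition shear (a : R) z : T :=
  z + vec4 (a * shear_coef (z ord0 ix1) (z ord0 ix2)) (- (a * shear_coef (z ord0 ix2) (z ord0 ix1))) 0 0.

Lemma shearE a z : [/\ shear a z ord0 iy1 = z ord0 iy1 + a * shear_coef (z ord0 ix1) (z ord0 ix2),
  shear a z ord0 iy2 = z ord0 iy2 - a * shear_coef (z ord0 ix2) (z ord0 ix1),
  shear a z ord0 ix1 = z ord0 ix1 & shear a z ord0 ix2 = z ord0 ix2].
Proof. by split; rewrite mxE vec4E ?addr0. Qed.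

Lemma shearK a : cancel (shear a) (shear (- a)).
Proof.
move=> z; have [e1 e2 e3 e4] := shearE a z; have [d1 d2 d3 d4] := shearE (- a) (shear a z).
apply: vec4_ext; rewrite ?d1 ?d2 ?d3 ?d4 ?e1 ?e2 ?e3 ?e4 //; ring.
Qed.

Lemma Ck_shear a k : Ck_on k [set: T] (shear a).
Proof.
pose x1 (z : T) : R := z ord0 ix1; pose x2 (z : T) : R := z ord0 ix2.
have [c1 c2] : Ck_on k setT x1 /\ Ck_on k setT x2 by split; exact: Ck_coord.
have Cg (y1 y2 : T -> R) : Ck_on k setT y1 -> Ck_on k setT y2 ->
    Ck_on k setT (fun z => shear_coef (y1 z) (y2 z)).
  move=> C1 C2; have -> : (fun z => shear_coef (y1 z) (y2 z)) =
    cst 2 * y1 ^+ 2 * y2 - cst (2 / 3) * y2 ^+ 3 by apply/funext.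
  by repeat first [exact: Ck_cst | assumption | apply: CkX | apply: CkN | apply: CkM
    | apply: CkD].
apply: CkD; first by apply: (@Ck_linear R _ _ k idfun) => z; exact: cvg_id.
have Cz : Ck_on k [set: T] (fun=> 0 : R) by exact: Ck_cst.
apply: Ck_vec4 (Cz) (Cz).
  by apply: (@CkM _ _ k (cst a)); [exact: Ck_cst|exact: Cg].
by apply: CkN; apply: (@CkM _ _ k (cst a)); [exact: Ck_cst|exact: Cg].
Qed.

Lemma shear_diffeo a : smooth_diffeo (shear a : 'rV[R]_(2 + 2) -> 'rV[R]_(2 + 2)).
Proof.
split; first by move=> k; exact: Ck_shear.
exists (shear (- a)); split; first by move=> k; exact: Ck_shear.
  exact: shearK.
by have := shearK (- a); rewrite opprK.
Qed.

Lemma omega4 u v : omega0 u v = u ord0 iy1 * v ord0 ix1 + u ord0 iy2 * v ord0 ix2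
  - u ord0 ix1 * v ord0 iy1 - u ord0 ix2 * v ord0 iy2.
Proof.
rewrite /omega0 /dot !big_ord_recl !big_ord0 !mxE !addr0 opprD addrA.
by congr (_ * _ + _ * _ - _ * _ - _ * _); congr (_ ord0 _); apply/val_inj.
Qed.

Lemma diff_shear a z v : let w := 'd (shear a) z v in
  [/\ w ord0 iy1 = v ord0 iy1 + a * (4 * z ord0 ix1 * z ord0 ix2 * v ord0 ix1
        + (2 * z ord0 ix1 ^+ 2 - 2 * z ord0 ix2 ^+ 2) * v ord0 ix2),
      w ord0 iy2 = v ord0 iy2 - a * (4 * z ord0 ix1 * z ord0 ix2 * v ord0 ix2
        + (2 * z ord0 ix2 ^+ 2 - 2 * z ord0 ix1 ^+ 2) * v ord0 ix1),
      w ord0 ix1 = v ord0 ix1 & w ord0 ix2 = v ord0 ix2].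
Proof.
move=> w; have ds : differentiable (shear a) z.
  by apply: (@smooth_on_differentiable _ _ _ [set: T]) => //; exact: (shear_diffeo a).1.
have wE i : w ord0 i = 'D_v (fun z => shear a z ord0 i) z.
  by rewrite /w -deriveE // (@derive_val _ _ _ _ _ _ _ (is_derive_coord v i ds)).
have d := is_derive_proj z v.
have [d1 d2] := (d ix1, d ix2); have [e1 e2] := (d iy1, d iy2).
split; rewrite wE.
- under eq_fun do rewrite (let: And4 E _ _ _ := shearE a _ in E).
  by rewrite /shear_coef; rewrite derive_val /GRing.scale /=; field.
- under eq_fun do rewrite (let: And4 _ E _ _ := shearE a _ in E).
  by rewrite /shear_coef; rewrite derive_val /GRing.scale /=; field.
- by under eq_fun do rewrite (let: And4 _ _ E _ := shearE a _ in E); rewrite derive_val.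
- by under eq_fun do rewrite (let: And4 _ _ _ E := shearE a _ in E); rewrite derive_val.
Qed.

Lemma shear_symplectic a : symplectic (shear a : 'rV[R]_(2 + 2) -> 'rV[R]_(2 + 2)).
Proof.
move=> z u v; rewrite !omega4.
have [-> -> -> ->] := diff_shear a z u; have [-> -> -> ->] := diff_shear a z v.
ring.
Qed.

Lemma row_mxE4 (y x : 'rV[R]_2) :
  (row_mx y x ord0 iy1 = fst2 y) * (row_mx y x ord0 iy2 = snd2 y) *
  (row_mx y x ord0 ix1 = fst2 x) * (row_mx y x ord0 ix2 = snd2 x).
Proof. by rewrite !row_mxEl !row_mxEr. Qed.

Lemma grad_G0 (x : 'rV[R]_2) : grad (@G0 R) x ord0 ord0 = shear_coef (fst2 x) (snd2 x) /\
  grad (@G0 R) x ord0 ord_max = - shear_coef (snd2 x) (fst2 x).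
Proof.
have d := @is_derive_proj R 2 x.
split; rewrite mxE.
  have d1 := d (basis_vec R (ord0 : 'I_2)) ord0; have d2 := d (basis_vec R (ord0 : 'I_2)) ord_max.
  rewrite !mxE /= in d1 d2.
  by rewrite /G0 /fst2 /snd2 derive_val /GRing.scale /shear_coef /=; field.
have d1 := d (basis_vec R (ord_max : 'I_2)) ord0; have d2 := d (basis_vec R (ord_max : 'I_2)) ord_max.
rewrite !mxE /= in d1 d2.
by rewrite /G0 /fst2 /snd2 derive_val /GRing.scale /shear_coef /=; field.
Qed.

Lemma shear_row_mx (y x : 'rV[R]_2) :
  shear 1 (row_mx y x) = row_mx (y + grad (@G0 R) x) x.
Proof.
have [e1 e2 e3 e4] := shearE 1 (row_mx y x); have [d1 d2] := grad_G0 x.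
apply: vec4_ext; rewrite ?e1 ?e2 ?e3 ?e4 !row_mxE4 // ?mul1r /fst2 /snd2 mxE.
  by rewrite d1.
by rewrite d2.
Qed.

Lemma submxE4 z :
  (fst2 (lsubmx z) = z ord0 iy1) * (snd2 (lsubmx z) = z ord0 iy2) *
  (fst2 (rsubmx z) = z ord0 ix1) * (snd2 (rsubmx z) = z ord0 ix2).
Proof. by rewrite /fst2 /snd2 !mxE. Qed.

Lemma hamiltonian_shear z : hamiltonian (shear 1 z) = Kh z.
Proof.
have [e1 e2 e3 e4] := shearE 1 z.
have dE : dot (rsubmx (shear 1 z)) (rsubmx (shear 1 z)) = z ord0 ix1 ^+ 2 + z ord0 ix2 ^+ 2.
  rewrite -e3 -e4 -!submxE4 /dot !big_ord_recl big_ord0 addr0 -!expr2 /fst2 /snd2.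
  by congr (_ + _ ^+ 2); congr (rsubmx _ _ _); apply/val_inj.
rewrite /hamiltonian /= potentialE /pot2 !submxE4 dE e1 e2 e3 e4 /Kh /khat /shear_coef.
by congr (_ + _); field.
Qed.

Lemma hill_sphere_shear E : E <= E_crit R ->
  shear 1 @^-1` hill_sphere E = shell (level E).
Proof.
move=> Ec; apply/seteqP; split => z; rewrite /hill_sphere /shell /= hamiltonian_shear hill_regionE //=;
have [e1 e2 e3 e4] := shearE 1 z;
have -> : dif2 (rsubmx (shear 1 z)) = Dif z by rewrite /dif2 !submxE4 e3 e4.
  by move=> [Kz [_ dz]].
move=> [Kz dz]; do !split => //.
have -> : pot2 (rsubmx (shear 1 z)) = Pot z by rewrite /pot2 !submxE4 e3 e4.
by rewrite -Kz; exact: Pot_le.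
Qed.

End Shear.

Theorem proposition2p6 (R : realType) :
  exists Phi : 'rV[R]_(2 + 2) -> 'rV[R]_(2 + 2),
    [/\ smooth_diffeo Phi /\ symplectic Phi,
        forall E : R, E <= E_crit R ->
          strictly_convex (Phi @^-1` hill_sphere E),
        forall y x : 'rV[R]_2,
          Phi (row_mx y x) = row_mx (y + grad (@G0 R) x) x
      & forall y x : 'rV[R]_2,
          hamiltonian (Phi (row_mx y x)) =
            (fst2 y - 8 / 3 * snd2 x ^+ 3) ^+ 2 / 2
            + (snd2 y + 8 / 3 * fst2 x ^+ 3) ^+ 2 / 2
            + 2 * (fst2 x ^+ 2 + snd2 x ^+ 2)
                * (2 - 3 * (fst2 x ^+ 2 - snd2 x ^+ 2) ^+ 2)].
Proof.
exists (shear 1); split.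
- by split; [exact: shear_diffeo|exact: shear_symplectic].
- move=> E Ec; rewrite hill_sphere_shear //.
  by apply: shell_strictly_convex; [exact: level_gt0|exact: level_le].
- exact: shear_row_mx.
move=> y x; rewrite hamiltonian_shear /Kh !row_mxE4 /khat /pot.
by congr (_ + _ + _); rewrite mulrC.
Qed.
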